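(* Let $f$ be a prime with $2\times 10^{20}\leq f\leq 4\times 10^{49}$ and $f\equiv 1\pmod 3$, and let $q_1<q_2$ be the two smallest primes that are cubic non-residues modulo $f$. If $q_1\geq 293$, then \[ q_1\leq q_2\leq 37 f^{0.232}. \]
   Context: Fix a Dirichlet character $\chi$ modulo $f$ of order $3$. An integer $n$ is a cubic non-residue modulo $f$ if $\chi(n)\notin\{0,1\}$ (independent of the choice of $\chi$). *)

(* Defs.v *)
From HB Require Import structures.
From mathcomp Require Import all_boot all_order all_algebra.
From mathcomp Require Import complex.
From mathcomp Require Import reals exp.

Set Implicit Arguments.
Unset Strict Implicit.
Unset Printing Implicit Defensive.

Import Order.TTheory GRing.Theory Num.Theory.
Local Open Scope ring_scope.
Local Open Scope complex_scope.

Definition dirichlet_character (R : realType) (f : nat) (chi : int -> R[i]) :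
    Prop :=
  [/\ forall n : int, chi (n + f%:Z) = chi n,
      forall m n : int, chi (m * n) = chi m * chi n
    & forall n : int, (chi n != 0) = coprimez n f%:Z].

Definition principal_character (R : realType) (f : nat) (n : int) : R[i] :=
  (coprimez n f%:Z)%:R.

(* The order of [chi] in the group of Dirichlet characters modulo [f]. *)
Definition character_order (R : realType) (f : nat) (chi : int -> R[i])
    (d : nat) : Prop :=
  [/\ (0 < d)%N,
      forall n : int, chi n ^+ d = principal_character R f n
    & forall k : nat, (0 < k < d)%N ->
        ~ (forall n : int, chi n ^+ k = principal_character R f n)].

(* Cubic non-residuosity modulo [f], for [chi] a character modulo [f] of
   order 3; the predicate does not depend on the choice of such a [chi]. *)
Definition cubic_nonresidue (R : realType) (chi : int -> R[i]) (n : int) :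
    bool :=
  chi n \notin [:: 0; 1].

Definition two_smallest (P : pred nat) (q1 q2 : nat) : Prop :=
  [/\ P q1, P q2, (q1 < q2)%N
    & forall p : nat, P p -> (p < q2)%N -> p = q1].

(* Main.v *)
Require Import Defs.
From HB Require Import structures.
From mathcomp Require Import all_boot all_order all_algebra.
From mathcomp Require Import all_solvable all_field.
From mathcomp Require Import complex reals sequences exp.
From mathcomp Require Import zify ring lra.

Set Implicit Arguments.
Unset Strict Implicit.
Unset Printing Implicit Defensive.

Import Order.TTheory GRing.Theory Num.Theory.
Local Open Scope ring_scope.
Local Open Scope complex_scope.

(** If q2 exceeds H = 37 f^0.232, then chi m = 1 for every m that is divisible
    neither by q1 nor by a prime above H.  An elementary Mertens estimate
    (through the multinomial coefficient (kH)!/(H!)^k and the primorial bound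
    4^n) shows that at most about 0.57 of the integers up to kH, roughly
    500 f^(3/8), have a prime factor above H, so Re chi is large on average
    there.  The Burgess method with fourth moments gives the opposite bound: in
    the sums over j of chi (n + j q), the fractions n / q modulo f repeat rarely
    when q is about f^(1/8) and n about f^(3/8), which leaves
    sum_z |sum_j chi (z + j)|^4.  Its off-diagonal terms are complete sums of
    chi over a quotient of two quadratic polynomials; sending one of the four
    roots to infinity turns them into point counts for y^3 = F(x) with F of
    degree 2 or 4, which Stepanov's method bounds with error O(sqrt f). *)

(** * Stepanov's method *)

(** Since [Re chi] is never below -1/2, an integer where chi is not 1 costs at most 3/2, and the
    contradiction needs the density of such integers to stay below 2/3. In a window of length about
    f^(3/8) that density is roughly ln ((3/8) / 0.232) = 0.48; the gap to 2/3 pays for elementary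
    prime estimates and explicit constants. For the opposite bound, chi (n + j q) = chi q * chi (n/q
    + j) turns the sum over j into one over consecutive residues. All q in [X, 2X) are used, so n/q
    need not be reduced; weights depending on gcd (q, n) absorb the resulting repetitions. The
    obstacle in the point count is a degree. Clearing denominators by cubes gives y^3 = F(x) with
    deg F = 6, and the terms of Stepanov's auxiliary polynomial have colliding degrees when 3
    divides deg F. Moving a root to infinity lowers the degree to 4, or to 2 when the two roots of
    the denominator coincide. *)

Lemma exists_nontrivial_solution (F : fieldType) (I J : finType)
    (a : I -> J -> F) :
  (#|J| < #|I|)%N ->
  exists2 v : I -> F, (exists i, v i != 0)
    & forall j, \sum_i v i * a i j = 0.
Proof.
move=> ltJI.
pose A : 'M[F]_(#|I|, #|J|) := \matrix_(i, j) a (enum_val i) (enum_val j).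
have rk : (0 < \rank (kermx A))%N.
  by rewrite mxrank_ker subn_gt0 (leq_ltn_trans (rank_leq_col _)).
have : kermx A != 0 by rewrite -mxrank_eq0 -lt0n.
case/rowV0Pn => u /sub_kermxP uA u0.
exists (fun i => u 0 (enum_rank i)).
  apply/existsP; apply: contraNT u0 => /existsPn h.
  apply/eqP/rowP => i; rewrite mxE; apply/eqP.
  by move: (h (enum_val i)); rewrite enum_valK negbK.
move=> j; have /rowP/(_ (enum_rank j)) := uA.
rewrite !mxE (reindex (@enum_rank I)) /=; last first.
  by exists enum_val => i _; rewrite ?enum_rankK ?enum_valK.
by move=> uA0; rewrite -[RHS]uA0; apply: eq_bigr => i _; rewrite !mxE !enum_rankK.
Qed.

(** Taylor expansion at x involves divided derivatives, and ordinary derivatives control these only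
    while l! is invertible; over F_p this allows M up to p. *)
Lemma dvdp_expXsubC_derivn (F : fieldType) (P : {poly F}) (x : F) (M : nat) :
  (forall l, (l < M)%N -> l`!%:R != 0 :> F) ->
  (forall l, (l < M)%N -> P^`(l).[x] = 0) ->
  ('X - x%:P) ^+ M %| P.
Proof.
move=> fact_neq0 deriv0.
have nderiv0 l : (l < M)%N -> P^`N(l).[x] = 0.
  move=> lM; have /eqP := deriv0 l lM.
  rewrite nderivn_def hornerMn -mulr_natr mulf_eq0.
  by rewrite (negbTE (fact_neq0 l lM)) orbF => /eqP.
have -> : P = \sum_(l < size P) (P^`N(l).[x])%:P * ('X - x%:P) ^+ l.
  have /nderiv_taylor : GRing.comm (x%:P : {poly F}) ('X - x%:P) by exact: mulrC.
  move=> /(_ (map_poly polyC P)); rewrite addrC subrK.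
  rewrite -[X in X = _]/((map_poly polyC P).['X]).
  have -> : (map_poly polyC P).['X] = P.
    by rewrite -[RHS]comp_polyXr.
  rewrite size_map_polyC => {1}->; apply: eq_bigr => l _.
  by rewrite nderivn_map horner_map.
elim/big_ind: _ => [|p q dp dq|l _]; rewrite ?dvdp0 ?dvdp_add//.
have [lM|Ml] := ltnP l M; first by rewrite nderiv0 // mul0r dvdp0.
by rewrite dvdp_mull // dvdp_exp2l.
Qed.

Lemma leq_mul_size_mup (F : fieldType) (P : {poly F}) (s : seq F) (M : nat) :
  P != 0 -> uniq s -> (forall x, x \in s -> ('X - x%:P) ^+ M %| P) ->
  (M * size s < size P)%N.
Proof.
elim: s P => [|x s IHs] P P0 /=; first by rewrite muln0 size_poly_gt0.
case/andP => xs us dvd; have /dvdpP[Q PQ] := dvd x (mem_head _ _).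
have Q0 : Q != 0 by apply: contraNneq P0 => Q0; rewrite PQ Q0 mul0r.
have /IHs : Q != 0 by [].
move=> /(_ us) ltQ; have {}ltQ : (M * size s < size Q)%N.
  apply: ltQ => y ys; have := dvd y; rewrite inE ys orbT PQ => /(_ isT).
  rewrite Gauss_dvdpl // coprimep_expl // coprimep_expr //.
  by rewrite coprimep_XsubC root_XsubC; apply: contraNneq xs => ->.
rewrite PQ size_Mmonic ?monic_exp ?monicXsubC // size_exp_XsubC addnS /=.
by rewrite mulnS addnC ltn_add2r.
Qed.

(** Formally [P^l * (k * P^c)^(l) = deriv_numerator P c l k * P^c]: the recursion is the product
    rule with denominators cleared. Setting the large power [P^c] aside keeps the degree small. *)
Fixpoint deriv_numerator (F : fieldType) (P : {poly F}) (c : F) (l : nat)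
    (k : {poly F}) : {poly F} :=
  if l is l'.+1 then
    let r := deriv_numerator P c l' k in
    P * r^`() + (c - l'%:R) *: (P^`() * r)
  else k.

Lemma size_deriv_numerator (F : fieldType) (P : {poly F}) (c : F) (l : nat)
    (k : {poly F}) (m : nat) :
  (size P <= m.+2)%N -> (size (deriv_numerator P c l k) <= size k + m * l)%N.
Proof.
move=> sP; elim: l => [|l IHl] /=; first by rewrite muln0 addn0.
set r := deriv_numerator _ _ _ _ in IHl *.
clearbody r; have [r0|r0] := eqVneq r 0.
  by rewrite r0 derivC mulr0 mulr0 scaler0 addr0 size_poly0.
have sr' : (size r^`() <= (size r).-1)%N by exact: size_poly.
have sP' : (size P^`() <= (size P).-1)%N by exact: size_poly.
have sr0 : (0 < size r)%N by rewrite size_poly_gt0.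
have arith a b b' n u v : (a <= n.+2 -> b <= u + v -> b' <= b.-1 -> 0 < b ->
    (a + b').-1 <= u + (n + v))%N by lia.
rewrite mulnS.
apply: leq_trans (size_polyD _ _) _; rewrite geq_max; apply/andP; split.
  have sM : (size (P * r^`())%R <= (size P + size r^`()).-1)%N.
    exact: size_polyMleq.
  by apply: (leq_trans sM); apply: (arith _ _ _ _ _ _ sP IHl sr' sr0).
apply: leq_trans (size_scale_leq _ _) _.
have sM : (size (P^`() * r)%R <= (size P^`() + size r).-1)%N.
  exact: size_polyMleq.
apply: (leq_trans sM).
have -> : (size P^`() + size r = (size P^`()).+1 + (size r).-1)%N by lia.
apply: (arith _ _ _ _ _ _ _ IHl (leqnn _) sr0).
by apply: leq_ltn_trans sP' _; case: (size P) sP.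
Qed.

Lemma deriv_expM_poly (F : fieldType) (P : {poly F}) (n : nat) :
  P * (P ^+ n)^`() = n%:R *: (P^`() * P ^+ n).
Proof.
case: n => [|n]; first by rewrite expr0 derivC mulr0 scale0r.
by rewrite deriv_exp /= scaler_nat mulrnAr mulrCA -exprS.
Qed.

(* In characteristic [p] the derivation treats the powers of ['X^p] as
   constants. *)
Lemma derivnM_numerator (F : fieldType) (p : nat) (P : {poly F}) (n j l : nat)
    (k : {poly F}) :
  p%:R = 0 :> F ->
  P ^+ l * (k * P ^+ n * 'X^(p * j))^`(l) =
  P ^+ n * deriv_numerator P n%:R l k * 'X^(p * j).
Proof.
move=> p0; elim: l => [|l IHl]; first by rewrite mul1r derivn0 /= (mulrC k).
have dX : ('X^(p * j))^`() = 0 :> {poly F}.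
  by rewrite derivXn -scaler_nat natrM p0 mul0r scale0r.
set U := (_ * _)^`(l) in IHl.
rewrite derivnS -/U.
have H : P ^+ l.+1 * U^`() = P * (P ^+ l * U)^`() - l%:R *: (P^`() * (P ^+ l * U)).
  rewrite derivM mulrDr [P * (_^`() * U)]mulrA deriv_expM_poly exprS.
  by rewrite -!mul_polyC; ring.
rewrite H IHl /= !derivM dX mulr0 addr0.
set r := deriv_numerator _ _ _ _.
have -> : P * (((P ^+ n)^`() * r + P ^+ n * r^`()) * 'X^(p * j)) =
    (n%:R *: (P^`() * P ^+ n)) * r * 'X^(p * j) + P ^+ n * (P * r^`()) * 'X^(p * j).
  by rewrite -deriv_expM_poly; ring.
by rewrite -!mul_polyC polyCB; ring.
Qed.

(** Modulo p = 3e+1 the numbers m e i for i = 0, 1, 2 are 0, 2e, e-1 if m = 2, and 0, e-1, 2e-2 if m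
    = 4. They are cyclically at least e-1 apart, so blocks of e-1 residues starting there are
    disjoint, and the residue of the degree determines i and d. *)
Lemma stepanov_degree_inj (e m i i' j j' d d' : nat) :
  (1 < e)%N -> m \in [:: 2; 4] -> (i < 3)%N -> (i' < 3)%N ->
  (d < e.-1)%N -> (d' < e.-1)%N ->
  (d + m * (e * i) + (3 * e).+1 * j = d' + m * (e * i') + (3 * e).+1 * j')%N ->
  [/\ i = i', j = j' & d = d'].
Proof.
have key a b c c' k :
    (1 < e)%N -> m \in [:: 2; 4] -> (a < 3)%N -> (b < 3)%N ->
    (c < e.-1)%N -> (c' < e.-1)%N ->
    (c + m * (e * a) = c' + m * (e * b) + (3 * e).+1 * k)%N ->
    [/\ a = b, k = 0 & c = c'].
  move=> e1 m24 a3 b3 ce ce'.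
  have [k0|k1|k2|k3] : [\/ k = 0, k = 1, k = 2 | (2 < k)%N].
    by case: k => [|[|[|k]]]; [constructor 1|constructor 2|constructor 3|constructor 4].
  - rewrite k0 => E; have : a = b /\ c = c'; last by case.
    move: m24 a3 b3 E; rewrite !inE => /orP[]/eqP->;
    by case: a => [|[|[|a]]] //; case: b => [|[|[|b]]] //; lia.
  - rewrite k1 => E; exfalso; move: m24 a3 b3 E; rewrite !inE => /orP[]/eqP->;
    by case: a => [|[|[|a]]] //; case: b => [|[|[|b]]] //; lia.
  - rewrite k2 => E; exfalso; move: m24 a3 b3 E; rewrite !inE => /orP[]/eqP->;
    by case: a => [|[|[|a]]] //; case: b => [|[|[|b]]] //; lia.
  (* For k at least 3 the right side is at least 9e+3, while the left side is at most 9e-2. *)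
  have ek : (3 * e <= e * k)%N by rewrite mulnC leq_mul2l k3 orbT.
  have -> : ((3 * e).+1 * k = 3 * (e * k) + k)%N by lia.
  move: (e * k)%N ek => ek lek E; exfalso; move: m24 a3 b3 E.
  rewrite !inE => /orP[]/eqP->;
  by case: a => [|[|[|a]]] //; case: b => [|[|[|b]]] //; lia.
move=> e1 m24 i3 i3' de de' E; have [jj|jj] := leqP j j'.
  have {}E : (d + m * (e * i) = d' + m * (e * i') + (3 * e).+1 * (j' - j))%N.
    by move: E; rewrite -{1}(subnK jj) mulnDr; lia.
  by have [] := key _ _ _ _ _ e1 m24 i3 i3' de de' E; split=> //; lia.
have {}E : (d' + m * (e * i') = d + m * (e * i) + (3 * e).+1 * (j - j'))%N.
  by move: E; rewrite -{1}(subnK (ltnW jj)) mulnDr; lia.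
by have [] := key _ _ _ _ _ e1 m24 i3' i3 de' de E; lia.
Qed.

Lemma sum_arith_progression (a b n : nat) :
  (2 * \sum_(l < n) (a + b * l) + b * n = 2 * a * n + b * n ^ 2)%N.
Proof.
elim: n => [|n IHn]; first by rewrite big_ord0 !muln0.
rewrite big_ord_recr /=; move: IHn; set s := (\sum_(i < n) _)%N.
by rewrite !expnS !expn0; lia.
Qed.

Lemma Fp_fact_neq0 (p l : nat) : prime p -> (l < p)%N -> l`!%:R != 0 :> 'F_p.
Proof.
move=> pp; elim: l => [|l IHl] lp; first by rewrite oner_eq0.
rewrite factS natrM mulf_neq0 ?IHl ?(ltnW lp) //.
by rewrite -(dvdn_pcharf (pchar_Fp pp)) gtnNdvd.
Qed.

(** The auxiliary polynomial combines X^d F^(ei) X^(pj) with i < 3, j < N+2, d < e-1. Where F(x)^e =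
    1 its derivatives reduce to polynomials of low degree that linear algebra can make identically
    zero. So it vanishes to order 3N at every counted point, while its degree is below p (N+4). *)
Lemma stepanov_cubic (p e N : nat) (F : {poly 'F_p}) :
  prime p -> p = (3 * e).+1 -> (1 < e)%N -> (0 < N)%N ->
  (11 * N ^ 2 + 4 <= 4 * e)%N -> size F \in [:: 3; 5] ->
  (3 * N * #|[set x : 'F_p | (F.[x] ^+ e == 1)%R]| < p * (N + 4))%N.
Proof.
move=> pp pe e1 N0 Ne sF.
pose J := N.+2; pose D := e.-1; pose M := (3 * N)%N.
pose m := (size F).-1.
have m24 : m \in [:: 2; 4] by move: sF; rewrite /m !inE => /orP[]/eqP->.
have sF5 : (size F <= 3.+2)%N by move: sF; rewrite !inE => /orP[]/eqP->.
have F0 : F != 0 by rewrite -size_poly_gt0; move: sF; rewrite !inE => /orP[]/eqP->.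
have p0 : p%:R = 0 :> 'F_p by apply/eqP; rewrite -(dvdn_pcharf (pchar_Fp pp)).
pose T1 := ('I_3 * 'I_J * 'I_D)%type.
(* The polynomial [red l t] below is F^l times the l-th derivative of a term, simplified by F(x)^e =
   1 and x^p = x. Its size is at most d + 1 + 3l + j with d < D and j <= N+1. *)
pose wid (l : 'I_M) := (D + N.+1 + 3 * l)%N.
pose T2 := {l : 'I_M & 'I_(wid l)}.
pose red (l : nat) (t : T1) : {poly 'F_p} :=
  deriv_numerator F (e * t.1.1)%:R l 'X^(t.2) * 'X^(t.1.2).
pose a (t : T1) (u : T2) : 'F_p := (red (tag u) t)`_(tagged u).
(* There are 3N(e-1) + (33N^2 - 3N)/2 conditions and 3N(e-1) + 6(e-1) unknowns; this comparison is
   the origin of [11 * N ^ 2 + 4 <= 4 * e]. *)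
have card12 : (#|{: T2}| < #|{: T1}|)%N.
  rewrite card_tagged !card_prod !card_ord sumnE big_map big_enum /=.
  under eq_bigr do rewrite card_ord.
  have := sum_arith_progression (D + N.+1) 3 M.
  rewrite /M /J /D; set s := (\sum_(i < _) _)%N.
  rewrite (_ : (3 * N) ^ 2 = 9 * N ^ 2)%N; last by rewrite expnMn.
  have -> : (2 * (e.-1 + N.+1) * (3 * N) = 6 * (e.-1 * N) + 6 * N ^ 2 + 6 * N)%N.
    by rewrite !expnS expn0; lia.
  have -> : (3 * N.+2 * e.-1 = 3 * (e.-1 * N) + 6 * e.-1)%N by lia.
  by lia.
have [v [t0 vt0] solv] := exists_nontrivial_solution a card12.
pose term (t : T1) : {poly 'F_p} := 'X^(t.2) * F ^+ (e * t.1.1) * 'X^(p * t.1.2).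
pose dg (t : T1) := (t.2 + m * (e * t.1.1) + (3 * e).+1 * t.1.2)%N.
have size_term t : size (term t) = (dg t).+1.
  have Fn0 n : F ^+ n != 0 by rewrite expf_neq0.
  have Xn0 n : 'X^n != 0 :> {poly 'F_p} by rewrite monic_neq0 ?monicXn.
  rewrite /term size_mulXn; last by rewrite mulf_neq0.
  rewrite ['X^_ * _]mulrC size_mulXn // -[size (F ^+ _)]prednK ?size_poly_gt0 //.
  by rewrite size_exp -/m /dg pe; lia.
have dg_inj : injective dg.
  move=> [[i j] d] [[i' j'] d'] /(stepanov_degree_inj e1 m24) /=.
  case/(_ (ltn_ord _) (ltn_ord _) (ltn_ord _) (ltn_ord _)) => ii jj dd.
  by congr (_, _, _); exact: val_inj.
pose P := \sum_t v t *: term t.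
(* The degrees [dg t] are distinct, so the highest term with nonzero coefficient cannot cancel. *)
have P0 : P != 0.
  pose ts := [arg max_(t > t0 | v t != 0) dg t].
  have [vts tsmax] : v ts != 0 /\ forall t, v t != 0 -> (dg t <= dg ts)%N.
    by rewrite /ts; case: arg_maxnP.
  apply/eqP => /(congr1 (fun q : {poly 'F_p} => q`_(dg ts))).
  rewrite coef0 coef_sum (bigD1 ts) //= big1 ?addr0; last first.
    move=> t1 tts; rewrite coefZ; have [->|vt] := eqVneq (v t1) 0; first exact: mul0r.
    rewrite nth_default ?mulr0 // size_term ltn_neqAle tsmax // andbT.
    by apply: contraNneq tts => /dg_inj ->.
  apply/eqP; rewrite coefZ mulf_neq0 //.
  have -> : (term ts)`_(dg ts) = lead_coef (term ts) by rewrite /lead_coef size_term.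
  by rewrite lead_coef_eq0 -size_poly_eq0 size_term.
have sizeP : (size P <= p * (N + 4))%N.
  apply: leq_trans (size_sum _ _ _) _; apply/bigmax_leqP => t _.
  apply: leq_trans (size_scale_leq _ _) _; rewrite size_term /dg -pe.
  have jJ : (p * t.1.2 <= p * N.+1)%N by rewrite leq_mul2l -ltnS ltn_ord orbT.
  have mi : (m * (e * t.1.1) <= 4 * (e * 2))%N.
    apply: leq_mul; first by move: m24; rewrite !inE => /orP[]/eqP->.
    by rewrite leq_mul2l -ltnS ltn_ord orbT.
  have := ltn_ord t.2; rewrite {2}/D.
  rewrite (_ : p * (N + 4) = p * N.+1 + 3 * p)%N; last by lia.
  move: (p * t.1.2)%N (p * N.+1)%N jJ mi => A B; move: (m * _)%N => C.
  by move: (nat_of_ord t.2) => d AB C8 de; lia.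
rewrite -/M cardE; apply: leq_trans sizeP.
apply: leq_mul_size_mup => //; first exact: enum_uniq.
move=> x; rewrite mem_enum inE => /eqP Fx1.
have Mp : (M <= p)%N.
  by move: Ne; rewrite /M pe !expnS expn0; nia.
apply: dvdp_expXsubC_derivn => l lM.
  by apply: Fp_fact_neq0 => //; apply: leq_trans lM Mp.
have Fx0 : F.[x] != 0.
  apply/eqP => Fx; move/esym/eqP: Fx1.
  by rewrite Fx expr0n gtn_eqF ?(ltnW e1) // oner_eq0.
have red0 : \sum_t v t *: red l t = 0.
  apply/polyP => c; rewrite coef0 coef_sum.
  have [cw|wc] := ltnP c (wid (Ordinal lM)).
    rewrite -[RHS](solv (Tagged (fun l => 'I_(wid l)) (Ordinal cw))).
    by apply: eq_bigr => t _; rewrite coefZ.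
  apply: big1 => t _; rewrite coefZ nth_default ?mulr0 //.
  apply: leq_trans wc; rewrite /red.
  have sD := size_deriv_numerator (e * t.1.1)%:R l 'X^(t.2) sF5.
  rewrite size_polyXn in sD.
  apply: leq_trans (size_polyMleq _ _) _; rewrite size_polyXn addnS /=.
  have td := ltn_ord t.2; have tj := ltn_ord t.1.2.
  apply: leq_trans (leq_add sD (leqnn _)) _; rewrite /wid /=.
  move: (nat_of_ord t.2) (nat_of_ord t.1.2) td tj => d j; rewrite /J {sD}.
  by clear; clearbody D => dD jJ; lia.
apply/eqP; rewrite -(mulrI_eq0 _ (mulfI (expf_neq0 l Fx0))).
have -> : F.[x] ^+ l * P^`(l).[x] = (\sum_t v t *: red l t).[x]; last first.
  by rewrite red0 horner0.
rewrite -horner_exp -hornerM /P linear_sum mulr_sumr !horner_sum.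
apply: eq_bigr => t _.
rewrite linearZ /= -scalerAr derivnM_numerator // !hornerZ; congr (_ * _).
rewrite /red !hornerM horner_exp exprM Fx1 expr1n mul1r !hornerXn.
congr (_ * _); rewrite exprM; congr (_ ^+ _).
by have := expf_card x; rewrite card_Fp.
Qed.

(** * The fourth moment of short character sums *)

Lemma ReD (R : rcfType) (x y : R[i]) :
  complex.Re (x + y) = complex.Re x + complex.Re y.
Proof. by case: x y => a b [c d]. Qed.

Lemma Re_sum (R : rcfType) (I : Type) (r : seq I) (P : pred I) (F : I -> R[i]) :
  complex.Re (\sum_(i <- r | P i) F i) = \sum_(i <- r | P i) complex.Re (F i).
Proof. exact: (big_morph (@complex.Re R) (@ReD R) (erefl _)). Qed.

Lemma cube_root_of_unity (R : rcfType) (z : R[i]) : z ^+ 3 = 1 ->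
  z = 1 \/ (complex.Re z = - (1 / 2) /\ complex.Im z ^+ 2 = 3 / 4).
Proof.
move=> z3; have [->|z1] := eqVneq z 1; [by left|right].
have : (z - 1) * (z ^+ 2 + z + 1) = 0.
  by rewrite (_ : _ * _ = z ^+ 3 - 1); [rewrite z3 subrr | ring].
move/eqP; rewrite mulf_eq0 subr_eq0 (negbTE z1) /= => /eqP.
case: z {z3} z1 => a b z1; rewrite expr2 => -[] /= E1 E2.
have b0 : b != 0.
  by apply/eqP => b0; move: E1; rewrite b0; nra.
have : b * (2 * a + 1) = 0 by rewrite -E2; ring.
move/eqP; rewrite mulf_eq0 (negbTE b0) /= => /eqP E.
have a2 : a = - (1 / 2) by lra.
by split=> //; move: E1; rewrite a2; nra.
Qed.

(** The norm on [R[i]] takes values in [R[i]]; the squared modulus is kept in R so that it can be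
    compared with real bounds. *)
Definition sqrnormc (R : rcfType) (z : R[i]) : R :=
  complex.Re z ^+ 2 + complex.Im z ^+ 2.

Lemma sqrnormcE (R : rcfType) (z : R[i]) : sqrnormc z = complex.Re (z * conjc z).
Proof. by case: z => a b; rewrite /sqrnormc /=; ring. Qed.

Lemma sqrnormcM (R : rcfType) (x y : R[i]) :
  sqrnormc (x * y) = sqrnormc x * sqrnormc y.
Proof. by case: x y => a b [c d]; rewrite /sqrnormc /=; ring. Qed.

Lemma conjc_cube_root (R : rcfType) (z : R[i]) : z ^+ 3 = 1 -> conjc z = z^-1.
Proof.
move=> z3; have z0 : z != 0.
  by apply: contra_eq_neq z3 => ->; rewrite expr0n /= eq_sym oner_eq0.
apply: (mulfI z0); rewrite divff //.
case: (cube_root_of_unity z3) => [->|]; first by rewrite conjc1 mulr1.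
case: z {z3 z0} => a b /= [-> b2]; apply/eqP; rewrite eq_complex /=.
by apply/andP; split; apply/eqP; [nra|ring].
Qed.

(** [cubic_char_kernel] is the link with Stepanov's count: with p = 3e+1, the value 1 is taken only
    at solutions of x^e = 1, the nonzero cubes. *)
Record cubic_char (R : rcfType) (p e : nat) (psi : 'F_p -> R[i]) : Prop :=
  CubicChar {
    cubic_charM : forall x y, psi (x * y) = psi x * psi y;
    cubic_char_eq0 : forall x, (psi x == 0) = (x == 0);
    cubic_char_cube : forall x, x != 0 -> psi x ^+ 3 = 1;
    cubic_char_kernel : forall x, psi x = 1 -> x ^+ e = 1 }.

Lemma cubic_char0 (R : rcfType) (p e : nat) (psi : 'F_p -> R[i]) :
  cubic_char e psi -> psi 0 = 0.
Proof. by move=> cpsi; apply/eqP; rewrite (cubic_char_eq0 cpsi). Qed.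

Lemma conjc_cubic_char (R : rcfType) (p e : nat) (psi : 'F_p -> R[i]) (x : 'F_p) :
  cubic_char e psi -> conjc (psi x) = psi x^-1.
Proof.
move=> cpsi; have [->|x0] := eqVneq x 0.
  by rewrite invr0 (cubic_char0 cpsi) conjc0.
have px0 : psi x != 0 by rewrite (cubic_char_eq0 cpsi).
have psi1 : psi 1 = 1.
  apply: (mulfI px0); by rewrite -(cubic_charM cpsi) !mulr1.
rewrite conjc_cube_root ?(cubic_char_cube cpsi) //.
by apply: (mulfI px0); rewrite divff // -(cubic_charM cpsi) divff.
Qed.

(** On units [Re psi] is 1 or -1/2, so an upper bound on a number of solutions already bounds a sum
    of real parts from above. *)
Lemma Re_cubic_char_le (R : rcfType) (p e : nat) (psi : 'F_p -> R[i]) (x : 'F_p) :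
  cubic_char e psi ->
  complex.Re (psi x) <= 3 / 2 * (x ^+ e == 1)%:R - 1 / 2 * (x != 0)%:R.
Proof.
move=> cpsi; have [->|x0] := eqVneq x 0.
  by rewrite (cubic_char0 cpsi) mulr0 subr0 mulr_ge0 //; lra.
case: (cube_root_of_unity (cubic_char_cube cpsi x0)) => [px|[-> _]].
  by rewrite px (cubic_char_kernel cpsi px) eqxx /=; lra.
by rewrite /=; case: (_ == _) => /=; lra.
Qed.

(** With y = 1/(z+d) each z+u equals (1 + (u-d) y)/y, and the quotient times the cube of (z+c) y is
    F(y), of degree 4, or 2 if c = d. The hypotheses [d != a] and [d != b] keep these degrees.
    Stepanov's bound then gives 3/2 (p/3 + 4p/(3N)) - (p-4)/2 = 2p/N + 2. *)
Lemma Re_sum_cubic_char_offdiag (R : rcfType) (p e N : nat) (psi : 'F_p -> R[i])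
    (a b c d : 'F_p) :
  prime p -> p = (3 * e).+1 -> (1 < e)%N -> (0 < N)%N ->
  (11 * N ^ 2 + 4 <= 4 * e)%N -> cubic_char e psi -> d != a -> d != b ->
  \sum_z complex.Re (psi ((z + a) * (z + b) / ((z + c) * (z + d))))
    <= 2 * p%:R / N%:R + 2.
Proof.
move=> pp pe e1 N0 Ne cpsi da db.
pose g z := (z + a) * (z + b) / ((z + c) * (z + d)).
pose lin (u : 'F_p) : {poly 'F_p} := u *: 'X + 1.
pose F := lin (a - d) * lin (b - d) * lin (c - d) ^+ 2.
have size_lin u : u != 0 -> size (lin u) = 2.
  move=> u0; rewrite /lin size_polyDl size_scale ?size_polyX //.
  by rewrite size_poly1.
have ad : a - d != 0 by rewrite subr_eq0 eq_sym.
have bd : b - d != 0 by rewrite subr_eq0 eq_sym.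
have lin0 u : u != 0 -> lin u != 0 by move=> u0; rewrite -size_poly_eq0 size_lin.
have sF : size F \in [:: 3; 5].
  have s3 : size (lin (a - d) * lin (b - d)) = 3.
    by rewrite size_mul ?lin0 // !size_lin.
  have [cd|cd] := eqVneq (c - d) 0.
    by rewrite /F cd /lin scale0r add0r expr1n mulr1 s3.
  by rewrite /F size_mul ?mulf_neq0 ?expf_neq0 ?lin0 // s3 expr2 size_mul ?lin0 // !size_lin.
have horner_lin u y : (lin u).[y] = u * y + 1.
  by rewrite /lin hornerD hornerZ hornerX hornerC.
have stp := stepanov_cubic pp pe e1 N0 Ne sF.
set n := #|[set x : 'F_p | F.[x] ^+ e == 1]| in stp.
pose S1 := [set z | g z ^+ e == 1]; pose S2 := [set z | g z != 0].
have cardg : (#|S1| <= n)%N.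
  rewrite /n -(card_in_imset (f := fun z => (z + d)^-1)); last first.
    by move=> x y _ _ /invr_inj /addIr.
  apply/subset_leq_card/subsetP => _ /imsetP[z zg ->]; move: zg; rewrite !inE => zg.
  have gz0 : g z != 0.
    apply/eqP => gz; move/eqP/esym/eqP: zg.
    by rewrite gz expr0n gtn_eqF ?(ltnW e1) // oner_eq0.
  have [zcd0] : (z + c) * (z + d) != 0.
    by move: gz0; rewrite /g mulf_eq0 invr_eq0 negb_or => /andP[].
  move: zcd0; rewrite mulf_eq0 negb_or => /andP[zc zd].
  set y := (z + d)^-1.
  have y0 : y != 0 by rewrite invr_eq0.
  have linE u : (lin (u - d)).[y] = (z + u) * y.
    by rewrite horner_lin -[1](mulVf zd) -/y; ring.
  have -> : F.[y] = g z * ((z + c) * y) ^+ 3.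
    rewrite /F !hornerM ?horner_exp !linE /g /y; field.
    by rewrite zc zd.
  rewrite exprMn -exprM (eqP zg) mul1r.
  have : ((z + c) * y) * ((z + c) * y) ^+ (3 * e) = (z + c) * y.
    by rewrite -exprS -[X in _ ^+ X]pe; have := expf_card ((z + c) * y); rewrite card_Fp.
  move=> xe; apply/eqP/(mulfI (mulf_neq0 zc y0)).
  by rewrite mulr1.
(* Division by 0 yields 0, so the poles of g count among its zeros: at most four points in all. *)
have cardz : (p <= #|S2| + 4)%N.
  have := cardsC S2; rewrite card_Fp // => {1}<-.
  rewrite leq_add2l; apply: leq_trans (card_size [:: - a; - b; - c; - d]).
  apply/subset_leq_card/subsetP => z; rewrite !inE negbK /g.
  rewrite !(mulf_eq0, invr_eq0) !addr_eq0.
  by case/orP => /orP[]->; rewrite ?orbT.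
have : \sum_z complex.Re (psi (g z)) <=
    3 / 2 * #|S1|%:R - 1 / 2 * #|S2|%:R.
  apply: le_trans (ler_sum _ (fun z _ => Re_cubic_char_le (g z) cpsi)) _.
  rewrite big_split /= sumrN -!mulr_sumr -!natr_sum.
  have cnt (P : pred 'F_p) : (\sum_z P z)%N = #|[set z | P z]|.
    by rewrite -sum1dep_card [RHS]big_mkcond; apply: eq_bigr => z _; case: (P z).
  by rewrite (cnt (fun z => g z ^+ e == 1)) (cnt (fun z => g z != 0)).
move=> /le_trans -> //.
have nR : (#|S1|%:R <= n%:R :> R) by rewrite ler_nat.
have zR : (p%:R <= #|S2|%:R + 4%:R :> R) by rewrite -natrD ler_nat.
have N0R : 0 < N%:R :> R by rewrite ltr0n.
have nR2 : 3 * N%:R * n%:R <= p%:R * (N%:R + 4) :> R.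
  by rewrite -!(natrM, natrD) ler_nat ltnW.
have nR3 : 3 * n%:R <= p%:R + 4 * (p%:R / N%:R) :> R.
  have := divfK (negbT (gt_eqF N0R)) p%:R.
  rewrite -(ler_pM2r N0R); move: (p%:R / N%:R) => q qN; lra.
rewrite -[_ * p%:R / _]mulrA; move: (p%:R / N%:R) nR3 => q; lra.
Qed.

Lemma Re_conjc (R : rcfType) (z : R[i]) : complex.Re (conjc z) = complex.Re z.
Proof. by case: z. Qed.

Lemma conjc_sum (R : rcfType) (I : Type) (r : seq I) (P : pred I)
    (F : I -> R[i]) :
  conjc (\sum_(i <- r | P i) F i) = \sum_(i <- r | P i) conjc (F i).
Proof. by apply: (big_morph (@conjc R)); [exact: rmorphD|exact: conjc0]. Qed.

Lemma Re_cubic_char_le1 (R : rcfType) (p e : nat) (psi : 'F_p -> R[i]) (x : 'F_p) :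
  cubic_char e psi -> complex.Re (psi x) <= 1.
Proof.
move=> cpsi; have [->|x0] := eqVneq x 0; first by rewrite (cubic_char0 cpsi) ler01.
apply: le_trans (Re_cubic_char_le x cpsi) _.
by rewrite x0; case: (_ == 1) => /=; lra.
Qed.

(* Unless {a, b} = {c, d}, one of the four shifts occurs on one side of the
   quotient only, and it can be sent to infinity. *)
Lemma Re_sum_cubic_char_quotient (R : rcfType) (p e N : nat)
    (psi : 'F_p -> R[i]) (a b c d : 'F_p) :
  prime p -> p = (3 * e).+1 -> (1 < e)%N -> (0 < N)%N ->
  (11 * N ^ 2 + 4 <= 4 * e)%N -> cubic_char e psi ->
  (c, d) != (a, b) -> (c, d) != (b, a) ->
  \sum_z complex.Re (psi ((z + a) * (z + b) / ((z + c) * (z + d))))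
    <= 2 * p%:R / N%:R + 2.
Proof.
move=> pp pe e1 N0 Ne cpsi cdab cdba.
have bound c' := Re_sum_cubic_char_offdiag c' pp pe e1 N0 Ne cpsi.
(* Conjugation inverts the quotient and keeps the real part, so a lone shift in the numerator can be
   moved to the denominator. *)
have flip a' b' c' d' :
    \sum_z complex.Re (psi ((z + a') * (z + b') / ((z + c') * (z + d')))) =
    \sum_z complex.Re (psi ((z + c') * (z + d') / ((z + a') * (z + b')))).
  apply: eq_bigr => z _.
  by rewrite -[LHS]Re_conjc (conjc_cubic_char _ cpsi) invf_div.
have swap a' b' c' d' :
    \sum_z complex.Re (psi ((z + a') * (z + b') / ((z + c') * (z + d')))) =
    \sum_z complex.Re (psi ((z + a') * (z + b') / ((z + d') * (z + c')))).
  by apply: eq_bigr => z _; rewrite [(z + c') * _]mulrC.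
have [da|da] := eqVneq d a; last first.
  have [db|db] := eqVneq d b; last exact: bound.
  have [ca|ca] := eqVneq c a; first by move: cdab; rewrite ca db eqxx.
  have [cb|cb] := eqVneq c b; last by rewrite swap; exact: bound.
  by rewrite flip swap; apply: bound; rewrite eq_sym ?cb -?db // eq_sym.
have [cb|cb] := eqVneq c b; first by move: cdba; rewrite cb da eqxx.
have [ca|ca] := eqVneq c a; last by rewrite swap; exact: bound.
have [ba|ba] := eqVneq b a; first by move: cb; rewrite ca ba eqxx.
by rewrite flip; apply: bound; rewrite ?ca ?da.
Qed.

(** Each pair (a, b) has at most two diagonal partners (c, d), where the trivial bound p is used.
    The condition [h <= p] keeps the shifts distinct in F_p, so every other pair falls under the
    quotient bound. *)
Lemma fourth_moment (R : rcfType) (p e N h : nat) (psi : 'F_p -> R[i]) :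
  prime p -> p = (3 * e).+1 -> (1 < e)%N -> (0 < N)%N ->
  (11 * N ^ 2 + 4 <= 4 * e)%N -> cubic_char e psi -> (h <= p)%N ->
  \sum_z sqrnormc (\sum_(j < h) psi (z + j%:R)) ^+ 2 <=
  2 * h%:R ^+ 2 * p%:R + h%:R ^+ 4 * (2 * p%:R / N%:R + 2).
Proof.
move=> pp pe e1 N0 Ne cpsi hp.
set B := 2 * p%:R / N%:R + 2.
have B0 : 0 <= B by rewrite addr_ge0 // mulr_ge0 ?invr_ge0 // mulr_ge0.
have ordI : injective (fun j : 'I_h => (j%:R : 'F_p)).
  move=> i j /(congr1 (@nat_of_ord _)).
  rewrite !val_Fp_nat // !modn_small ?(leq_trans (ltn_ord _) hp) //.
  exact: val_inj.
pose g (u v : 'I_h * 'I_h) (z : 'F_p) :=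
  (z + u.1%:R) * (z + u.2%:R) / ((z + v.1%:R) * (z + v.2%:R)).
have expand z : sqrnormc (\sum_(j < h) psi (z + j%:R)) ^+ 2 =
    \sum_u \sum_v complex.Re (psi (g u v z)).
  have sq : (\sum_(j < h) psi (z + j%:R)) ^+ 2 =
      \sum_(u : 'I_h * 'I_h) psi ((z + u.1%:R) * (z + u.2%:R)).
    rewrite expr2 big_distrlr /= pair_bigA /=.
    by apply: eq_bigr => u _; rewrite (cubic_charM cpsi).
  rewrite expr2 -sqrnormcM -expr2 sq sqrnormcE.
  rewrite conjc_sum big_distrlr /= Re_sum.
  apply: eq_bigr => u _; rewrite Re_sum; apply: eq_bigr => v _.
  by rewrite (conjc_cubic_char _ cpsi) -(cubic_charM cpsi).
under eq_bigr do rewrite expand.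
rewrite exchange_big /=.
have bound u : \sum_z \sum_v complex.Re (psi (g u v z)) <= 2 * p%:R + h%:R ^+ 2 * B.
  rewrite exchange_big /=.
  have term v : \sum_z complex.Re (psi (g u v z)) <=
      p%:R * ((v == u)%:R + (v == (u.2, u.1))%:R) + B.
    have [vu|vu] := boolP ((v == u) || (v == (u.2, u.1))).
      have le_p : \sum_z complex.Re (psi (g u v z)) <= p%:R.
        apply: le_trans (ler_sum _ (fun z _ => Re_cubic_char_le1 (g u v z) cpsi)) _.
        by rewrite sumr_const card_Fp.
      have p0 : 0 <= p%:R :> R by [].
      by move: vu; case: (v == u); case: (v == (u.2, u.1)) => //= _; nra.
    case/norP: vu => vu vu'; rewrite (negbTE vu) (negbTE vu') addr0 mulr0 add0r.
    apply: (Re_sum_cubic_char_quotient pp pe e1 N0 Ne cpsi).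
      apply: contraNneq vu => -[/ordI E1 /ordI E2].
      by rewrite -pair_eqE /= E1 E2 !eqxx.
    apply: contraNneq vu' => -[/ordI E1 /ordI E2].
    by rewrite -pair_eqE /= E1 E2 !eqxx.
  apply: le_trans (ler_sum _ (fun v _ => term v)) _.
  rewrite big_split /= -mulr_sumr big_split /= sumr_const card_prod card_ord.
  have sum_eq w : \sum_(v : 'I_h * 'I_h) ((v == w)%:R : R) = 1.
    by rewrite (bigD1 w) //= eqxx big1 ?addr0 // => v /negbTE ->.
  rewrite !sum_eq -[B *+ _]mulr_natl natrM; lra.
apply: le_trans (ler_sum _ (fun u _ => bound u)) _.
rewrite sumr_const card_prod card_ord -[leLHS]mulr_natl natrM.
by rewrite le_eqVlt; apply/orP; left; apply/eqP; ring.
Qed.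

(** * Averaging over fractions *)

(** This is the tangent to r^4 at r = t, a linearised Hölder inequality: no fourth roots appear, and
    t may vary from term to term. *)
Lemma tangent_fourth_power (R : realFieldType) (r t : R) :
  0 < t -> r <= 3 / 4 * t + r ^+ 4 / (4 * t ^+ 3).
Proof.
move=> t0; have tn0 : t != 0 by rewrite gt_eqF.
rewrite -subr_ge0; have -> : 3 / 4 * t + r ^+ 4 / (4 * t ^+ 3) - r =
  (r - t) ^+ 2 * ((r + t) ^+ 2 + 2 * t ^+ 2) / (4 * t ^+ 3) by field.
apply: divr_ge0; last by rewrite mulr_ge0 ?exprn_ge0 ?ltW.
by rewrite mulr_ge0 ?sqr_ge0 // addr_ge0 ?sqr_ge0 // mulr_ge0 ?sqr_ge0.
Qed.

(** If m is the least value, the values are distinct integers of [m, 2m), so there are at most m of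
    them, each with reciprocal at most 1/m. *)
Lemma sum_inv_half_range (R : realFieldType) (T : finType) (A : {set T})
    (g : T -> nat) :
  {in A &, injective g} -> {in A, forall u, 0 < g u}%N ->
  {in A &, forall u v, g u < 2 * g v}%N ->
  \sum_(u in A) (g u)%:R^-1 <= 1 :> R.
Proof.
move=> gI g0 g2; have [->|[u0 u0A]] := set_0Vmem A.
  by rewrite big_set0 ler01.
pose u1 := [arg min_(u < u0 in A) g u].
have [u1A u1min] : u1 \in A /\ {in A, forall u, g u1 <= g u}%N.
  by rewrite /u1; case: arg_minnP.
have cardA : (#|A| <= g u1)%N.
  rewrite cardE -(size_map g) -(size_iota (g u1) (g u1)).
  apply: uniq_leq_size.
    by rewrite map_inj_in_uniq ?enum_uniq // => u v; rewrite !mem_enum; apply: gI.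
  move=> _ /mapP[u uA ->]; rewrite mem_enum in uA.
  by rewrite mem_iota u1min //= addnn -mul2n g2.
have gR : 0 < (g u1)%:R :> R by rewrite ltr0n g0.
apply: (@le_trans _ _ (\sum_(u in A) (g u1)%:R^-1)).
  apply: ler_sum => u uA.
  by rewrite lef_pV2 ?posrE ?ltr0n ?g0 // ler_nat u1min.
rewrite sumr_const -[_ *+ _]mulr_natr mulrC ler_pdivrMr // mul1r ler_nat //.
Qed.

(* The constant is slightly above 2 / sqrt 27, the least c for which
   (1 + c s)^3 >= s^2 holds for all s >= 0. *)
Definition gcd_weight (R : rcfType) (g : nat) : R :=
  1 + (1 < g)%N%:R * (77 / 200 * Num.sqrt g%:R).

Lemma gcd_weight_ge1 (R : rcfType) (g : nat) : 1 <= gcd_weight R g.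
Proof.
by rewrite lerDl mulr_ge0 // mulr_ge0 ?sqrtr_ge0 // divr_ge0.
Qed.

(** When the tangent point is scaled by the weight, the fourth power is divided by the cube of the
    weight; the inequality makes this a factor at most 1/g. *)
Lemma le_cube_gcd_weight (R : rcfType) (g : nat) :
  (0 < g)%N -> g%:R <= gcd_weight R g ^+ 3.
Proof.
case: g => [//|[|g]] _; first by rewrite /gcd_weight mul0r addr0 expr1n.
rewrite /gcd_weight mul1r; set s := Num.sqrt _.
have s0 : 0 <= s by exact: sqrtr_ge0.
have -> : g.+2%:R = s ^+ 2 :> R by rewrite sqr_sqrtr.
set u := 77 / 200 * s.
have -> : s ^+ 2 = (200 / 77 * u) ^+ 2.
  by congr (_ ^+ 2); rewrite /u; field.
have u0 : 0 <= u by rewrite mulr_ge0 // divr_ge0.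
rewrite -subr_ge0.
(* The first product is (1+u)^3 - 27/4 u^2, which has the double root u = 2; the second is
   nonnegative because (200/77)^2 < 27/4. *)
have -> : (1 + u) ^+ 3 - (200 / 77 * u) ^+ 2 =
    (u - 2) ^+ 2 * (u + 1 / 4) + (27 / 4 - (200 / 77) ^+ 2) * u ^+ 2 by field.
rewrite addr_ge0 // mulr_ge0 ?sqr_ge0 //; first by lra.
by rewrite expr2; lra.
Qed.

(** * Averages of the gcd weight *)

Lemma sum_dvdn_le (g a n : nat) :
  (0 < g)%N -> (\sum_(k < n) (g %| a.+1 + k) <= n %/ g + 1)%N.
Proof.
move=> g0; have -> : (\sum_(k < n) (g %| a.+1 + k) = (a + n) %/ g - a %/ g)%N.
  elim: n => [|n IHn]; first by rewrite big_ord0 addn0 subnn.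
  rewrite big_ord_recr /= IHn addnS divnS // addSn.
  by rewrite addnC addnBA ?leq_div2r ?leq_addr.
by rewrite leq_subLR divnD // addnA leq_add2l leq_b1.
Qed.

Lemma sqrt_natrS_inv_le (R : rcfType) (n : nat) : (0 < n)%N ->
  (Num.sqrt n.+1%:R)^-1 <= 2 * (Num.sqrt n.+1%:R - Num.sqrt n%:R) :> R.
Proof.
move=> n0; have: n.+1%:R = n%:R + 1 :> R by rewrite -natr1.
rewrite -[n.+1%:R in X in X -> _](@sqr_sqrtr R) // -[n%:R in X in X -> _](@sqr_sqrtr R) //.
have : 0 < Num.sqrt n%:R :> R by rewrite sqrtr_gt0 ltr0n.
have : 0 < Num.sqrt n.+1%:R :> R by rewrite sqrtr_gt0 ltr0n.
move: (Num.sqrt _) (Num.sqrt _) => s t s0 t0 st.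
rewrite -(ler_pM2r s0) mulVf ?gt_eqF //; nra.
Qed.

Lemma sum_inv_sqrt_le (R : rcfType) (n : nat) :
  \sum_(2 <= g < n) (Num.sqrt g%:R)^-1 <= 2 * Num.sqrt n%:R :> R.
Proof.
have [n2|n2] := leqP n 2; first by rewrite big_geq // mulr_ge0 ?sqrtr_ge0.
apply: (@le_trans _ _ (\sum_(2 <= g < n)
    (2 * (Num.sqrt g%:R - Num.sqrt g.-1%:R)))).
  rewrite !big_nat; apply: ler_sum => -[|[|g]] // _; exact: sqrt_natrS_inv_le.
rewrite -mulr_sumr ler_pM2l // -[n]prednK ?(ltn_trans _ n2) // big_add1 /=.
rewrite telescope_sumr; last by lia.
rewrite lerBlDr; apply: (@le_trans _ _ (Num.sqrt n.-1.+1%:R)).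
  by rewrite ler_sqrt ?ler_nat // ltr0n.
by rewrite lerDl sqrtr_ge0.
Qed.

Lemma sum_sqrt_le (R : rcfType) (n : nat) :
  \sum_(2 <= g < n) Num.sqrt g%:R <= n%:R * Num.sqrt n%:R :> R.
Proof.
apply: (@le_trans _ _ (\sum_(2 <= g < n) Num.sqrt n%:R)).
  rewrite !big_nat; apply: ler_sum => g /andP[_ gn].
  by rewrite ler_wsqrtr // ler_nat ltnW.
rewrite sumr_const_nat -[_ *+ _]mulr_natl ler_wpM2r ?sqrtr_ge0 // ler_nat.
exact: leq_subr.
Qed.

Lemma sqrt_cube_inv_le (R : rcfType) (n : nat) : (0 < n)%N ->
  Num.sqrt n.+1%:R / n.+1%:R ^+ 2 <=
  2 * ((Num.sqrt n%:R)^-1 - (Num.sqrt n.+1%:R)^-1) :> R.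
Proof.
move=> n0; have : 0 < Num.sqrt n%:R :> R by rewrite sqrtr_gt0 ltr0n.
have : 0 < Num.sqrt n.+1%:R :> R by rewrite sqrtr_gt0 ltr0n.
have : n.+1%:R = Num.sqrt n.+1%:R ^+ 2 :> R by rewrite sqr_sqrtr.
have : n%:R = Num.sqrt n%:R ^+ 2 :> R by rewrite sqr_sqrtr.
have : n.+1%:R = n%:R + 1 :> R by rewrite -natr1.
move: (n.+1%:R : R) (n%:R : R) (Num.sqrt (n.+1%:R : R)) (Num.sqrt (n%:R : R)).
move=> u v s t uv vt us s0 t0.
have {uv} st : s ^+ 2 = t ^+ 2 + 1 by rewrite -us uv vt.
rewrite us {us vt}.
have d0 : 0 < s ^+ 3 * t by rewrite mulr_gt0 ?exprn_gt0.
rewrite -(ler_pM2r d0).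
have -> : s / s ^+ 2 ^+ 2 * (s ^+ 3 * t) = t by field; rewrite gt_eqF.
have -> : 2 * (t^-1 - s^-1) * (s ^+ 3 * t) = 2 * s ^+ 2 * (s - t).
  by field; rewrite !gt_eqF.
rewrite -(ler_pM2r (addr_gt0 s0 t0)).
have -> : 2 * s ^+ 2 * (s - t) * (s + t) = 2 * s ^+ 2 * (s ^+ 2 - t ^+ 2) by ring.
rewrite {2}st [t ^+ 2 + 1]addrC addrK mulr1.
have := sqr_ge0 (s - t); nra.
Qed.

(** The terms are g^(-3/2). Those for g = 2, 3, 4 are estimated individually, and the tail from 5
    telescopes to at most 2 / sqrt 4 = 1. *)
Lemma sum_sqrt_cube_inv_le (R : rcfType) (n : nat) :
  \sum_(2 <= g < n) Num.sqrt g%:R / g%:R ^+ 2 <= 42 / 25 :> R.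
Proof.
have term0 g : 0 <= Num.sqrt g%:R / g%:R ^+ 2 :> R.
  by rewrite divr_ge0 ?sqrtr_ge0 ?exprn_ge0.
(* Extending the range to n + 5 lets these three terms be split off for every n. *)
apply: (@le_trans _ _ (\sum_(2 <= g < n + 5) Num.sqrt g%:R / g%:R ^+ 2)).
  have [n2|n2] := leqP n 2; first by rewrite big_geq // sumr_ge0.
  rewrite [leRHS](@big_cat_nat _ _ _ n) ?leq_addr ?(ltnW n2) //=.
  by rewrite lerDl sumr_ge0.
rewrite (@big_cat_nat _ _ _ 5) ?leq_addl //= big_nat_recl // big_nat_recl //.
rewrite big_nat1.
have sq (m : nat) (q : R) : 0 <= q -> m%:R <= q ^+ 2 -> Num.sqrt m%:R <= q.
  by move=> q0 mq; rewrite -[q]ger0_norm // -sqrtr_sqr ler_wsqrtr.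
have s2 : Num.sqrt 2%:R <= 99 / 70 :> R by apply: sq; lra.
have s3 : Num.sqrt 3%:R <= 97 / 56 :> R by apply: sq; lra.
have s4 : Num.sqrt 4%:R = 2 :> R.
  by rewrite (natrX _ 2 2) sqrtr_sqr ger0_norm.
have tail m : \sum_(5 <= g < m + 5) Num.sqrt g%:R / g%:R ^+ 2 <=
    2 * ((Num.sqrt 4%:R)^-1 - (Num.sqrt (m + 4)%:R)^-1) :> R.
  elim: m => [|m IHm]; first by rewrite big_geq // subrr mulr0.
  rewrite addSn big_nat_recr ?leq_addl //=.
  have := @sqrt_cube_inv_le R (m + 4); rewrite -addnS addn_gt0 orbT => /(_ isT).
  rewrite addSnnS.
  by move=> step; apply: le_trans (lerD IHm step) _; rewrite -mulrDr addrA subrK.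
have {tail}tail : \sum_(5 <= g < n + 5) Num.sqrt g%:R / g%:R ^+ 2 <= 1 :> R.
  apply: le_trans (tail n) _; rewrite s4.
  have : 0 <= (Num.sqrt (n + 4)%:R)^-1 :> R by rewrite invr_ge0 sqrtr_ge0.
  lra.
move: s2 s3 tail; rewrite /= s4.
move: (Num.sqrt 2%:R) (Num.sqrt 3%:R) (\sum_(_ <= _ < _) _) => a b c; lra.
Qed.

(** The number on the right is i - y + g (y+1); adding a multiple of g moves the window into the
    positive integers, where [sum_dvdn_le] counts. *)
Lemma dvdn_absz_shift (g y i : nat) : (0 < g)%N ->
  (g %| `|i%:Z - y%:Z|)%N -> (g %| (g.-1 * y + g.-1).+1 + i)%N.
Proof.
case: g => // g _ /= gd; have gg : (g.+1 %| g.+1 * y + g.+1)%N.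
  exact: dvdn_add (dvdn_mulr _ (dvdnn _)) (dvdnn _).
have [yi|iy] := leqP y i.
  have -> : ((g * y + g).+1 + i = g.+1 * y + g.+1 + (i - y))%N.
    by rewrite mulSn; lia.
  by rewrite dvdn_addr //; move: gd; rewrite distnEl.
have -> : ((g * y + g).+1 + i = g.+1 * y + g.+1 - (y - i))%N.
  by rewrite mulSn; lia.
rewrite dvdn_subr //; last by rewrite mulSn; lia.
by move: gd; rewrite (distnEr (ltnW iy)).
Qed.

Lemma natr_divn_le (R : realFieldType) (m d : nat) :
  (0 < d)%N -> (m %/ d)%:R <= m%:R / d%:R :> R.
Proof. by move=> d0; rewrite ler_pdivlMr ?ltr0n // -natrM ler_nat leq_trunc_div. Qed.

(** For a gcd d > 1, sqrt d is at most the sum of sqrt g over all common divisors g >= 2. Exchanging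
    sums leaves sqrt g (X/g + 1)(n/g + 1), which splits into sums of g^(-3/2), g^(-1/2) and
    g^(1/2). *)
Lemma sum_gcd_weight (R : rcfType) (X n y : nat) : (0 < X)%N ->
  \sum_(u : 'I_X * 'I_n)
     gcd_weight R (gcdn (X + u.1) `|u.2%:Z - y%:Z|) <=
  X%:R * n%:R + 77 / 200 * (42 / 25 * (X%:R * n%:R) +
    (2 * X%:R + 2 * (X%:R + n%:R)) * Num.sqrt (2 * X%:R)).
Proof.
move=> X0; rewrite /gcd_weight big_split /=.
rewrite sumr_const card_prod !card_ord -natrM lerD2l.
pose s g : R := Num.sqrt g%:R.
have s0 g : 0 <= s g by exact: sqrtr_ge0.
pose cq g := (\sum_(k < X) (g %| X + k))%N.
pose cn g := (\sum_(i < n) (g %| `|i%:Z - y%:Z|))%N.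
have cqE g : (0 < g)%N -> (cq g <= X %/ g + 1)%N.
  by move=> g0; have := sum_dvdn_le X.-1 X g0; rewrite (prednK X0).
have cnE g : (0 < g)%N -> (cn g <= n %/ g + 1)%N.
  move=> g0; apply: leq_trans (sum_dvdn_le (g.-1 * y + g.-1) n g0).
  apply: leq_sum => i _; case: (boolP (g %| _)%N) => // gd.
  by rewrite (dvdn_absz_shift g0 gd).
have le_pair (u : 'I_X * 'I_n) : (1 < gcdn (X + u.1) `|u.2%:Z - y%:Z|)%N%:R *
      (77 / 200 * Num.sqrt (gcdn (X + u.1) `|u.2%:Z - y%:Z|)%:R) <=
    77 / 200 * \sum_(2 <= g < 2 * X)
      s g * ((g %| X + u.1)%N%:R * (g %| `|u.2%:Z - y%:Z|)%N%:R)
    :> R.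
  set d := gcdn _ _.
  have term0 g : 0 <= s g * ((g %| X + u.1)%N%:R * (g %| `|u.2%:Z - y%:Z|)%N%:R).
    by rewrite !mulr_ge0.
  have [d1|d1] := leqP d 1.
    rewrite mul0r; apply: mulr_ge0; first by rewrite divr_ge0.
    by apply: sumr_ge0 => g _; exact: term0.
  rewrite mul1r ler_pM2l; last by lra.
  have dX : (d < 2 * X)%N.
    have : (d <= X + u.1)%N by rewrite dvdn_leq ?dvdn_gcdl // addn_gt0 X0.
    by have := ltn_ord u.1; lia.
  rewrite (bigD1_seq d) ?mem_index_iota ?d1 ?iota_uniq //=.
  by rewrite dvdn_gcdl dvdn_gcdr !mulr1 lerDl sumr_ge0 // => g _; exact: term0.
apply: le_trans (ler_sum _ (fun u _ => le_pair u)) _.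
rewrite -mulr_sumr ler_pM2l; last by lra.
rewrite exchange_big /=.
have split_sum g : \sum_(u : 'I_X * 'I_n)
    s g * ((g %| X + u.1)%N%:R * (g %| `|u.2%:Z - y%:Z|)%N%:R) =
    s g * ((cq g)%:R * (cn g)%:R).
  rewrite -mulr_sumr; congr (_ * _); rewrite /cq /cn !natr_sum big_distrlr /=.
  by rewrite pair_bigA.
under eq_bigr do rewrite split_sum.
apply: (@le_trans _ _ (\sum_(2 <= g < 2 * X)
    (X%:R * n%:R * (s g / g%:R ^+ 2) + (X%:R + n%:R) * (s g)^-1 + s g))).
  rewrite !big_nat; apply: ler_sum => g /andP[g2 _].
  have g0 : (0 < g)%N by apply: leq_trans g2.
  have gR : 0 < g%:R :> R by rewrite ltr0n.
  have sg : 0 < s g by rewrite sqrtr_gt0.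
  have sE : g%:R = s g ^+ 2 by rewrite sqr_sqrtr ?ltW.
  have qb : (cq g)%:R <= X%:R / g%:R + 1 :> R.
    apply: (@le_trans _ _ (X %/ g + 1)%:R); first by rewrite ler_nat cqE.
    by rewrite natrD lerD2r natr_divn_le.
  have nb : (cn g)%:R <= n%:R / g%:R + 1 :> R.
    apply: (@le_trans _ _ (n %/ g + 1)%:R); first by rewrite ler_nat cnE.
    by rewrite natrD lerD2r natr_divn_le.
  apply: (@le_trans _ _ (s g * ((X%:R / g%:R + 1) * (n%:R / g%:R + 1)))).
    by rewrite ler_pM2l // ler_pM.
  rewrite le_eqVlt; apply/orP; left; apply/eqP; rewrite sE; field.
  by rewrite gt_eqF.
rewrite !big_split /= -!mulr_sumr.
have Q0 : 0 <= Num.sqrt (2 * X%:R) :> R by exact: sqrtr_ge0.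
have b1 := sum_sqrt_cube_inv_le R (2 * X).
have := sum_inv_sqrt_le R (2 * X); rewrite natrM => b2.
have := sum_sqrt_le R (2 * X); rewrite natrM => b3.
have c1 : X%:R * n%:R * \sum_(2 <= g < 2 * X) s g / g%:R ^+ 2 <=
    X%:R * n%:R * (42 / 25) by rewrite ler_wpM2l ?mulr_ge0.
have c2 : (X%:R + n%:R) * \sum_(2 <= g < 2 * X) (s g)^-1 <=
    (X%:R + n%:R) * (2 * Num.sqrt (2 * X%:R)) by rewrite ler_wpM2l ?addr_ge0.
apply: le_trans (lerD (lerD c1 c2) b3) _.
rewrite le_eqVlt; apply/orP; left; apply/eqP; ring.
Qed.

(** * Coincidences of fractions modulo p *)

Lemma intr_Fp_eq0 (p : nat) (m : int) : prime p -> (`|m| < p)%N ->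
  (m%:~R == 0 :> 'F_p) = (m == 0).
Proof.
move=> pp mp; have nat_case n : (n < p)%N -> (n%:R == 0 :> 'F_p) = (n == 0%N).
  move=> np; rewrite -(dvdn_pcharf (pchar_Fp pp)).
  by case: n np => [|n] np; rewrite ?dvdn0 // gtnNdvd.
case: m mp => n mp; first exact: nat_case.
by rewrite NegzE mulrNz oppr_eq0 nat_case // oppr_eq0.
Qed.

(** If n/q and n'/q' agree modulo p, then n q' - n' q is a multiple of p of size at most 4Xy < p,
    hence 0. So a fibre consists of multiples of one reduced fraction, determined by their gcds; as
    q ranges over [X, 2X), these gcds stay within a factor 2. *)
Lemma sum_inv_gcd_fibre (R : realFieldType) (p X y : nat) (s z : 'F_p) :
  prime p -> (0 < X)%N -> (4 * X * y + 2 * X < p)%N ->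
  \sum_(u : 'I_X * 'I_(2 * y).+1 |
      (u.2%:Z - y%:Z)%:~R / (X + u.1)%:R + s == z)
    (gcdn (X + u.1) `|u.2%:Z - y%:Z|)%:R^-1 <= 1 :> R.
Proof.
move=> pp X0 Xyp.
pose q (u : 'I_X * 'I_(2 * y).+1) := (X + u.1)%N.
pose n (u : 'I_X * 'I_(2 * y).+1) : int := u.2%:Z - y%:Z.
pose g u := gcdn (q u) `|n u|.
pose A := [set u | (n u)%:~R / (q u)%:R + s == z].
have qX u : (q u < 2 * X)%N by rewrite mul2n -addnn ltn_add2l.
have q0 u : (0 < q u)%N by rewrite addn_gt0 X0.
have ny u : (`|n u| <= y)%N by have := ltn_ord u.2; rewrite /n; lia.
have qF u : (q u)%:R != 0 :> 'F_p.
  have := @intr_Fp_eq0 p (q u) pp; rewrite -pmulrn => ->.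
    by have := q0 u; rewrite lt0n.
  by rewrite absz_nat; apply: leq_trans (qX u) _; lia.
have cross u v : u \in A -> v \in A -> n u * (q v)%:Z = n v * (q u)%:Z.
  rewrite !inE => /eqP uz /eqP; rewrite -uz => /addIr /eqP.
  rewrite eqr_div // => E; apply/eqP; rewrite -subr_eq0.
  rewrite -(@intr_Fp_eq0 p) //.
    by rewrite intrB !intrM -!pmulrn subr_eq0 eq_sym.
  have h (a b : int) (c d : nat) : (`|a| <= y)%N -> (`|b| <= y)%N ->
      (c < 2 * X)%N -> (d < 2 * X)%N -> (`|(a * c%:Z - b * d%:Z)%R| <= 4 * X * y)%N.
    move=> ay byy cX dX.
    have h1 : (`|(a * c%:Z)%R| <= y * (2 * X))%N by rewrite abszM leq_mul // ltnW.
    have h2 : (`|(b * d%:Z)%R| <= y * (2 * X))%N by rewrite abszM leq_mul // ltnW.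
    by move: (a * c%:Z) (b * d%:Z) h1 h2 => a1 b1; lia.
  by apply: leq_ltn_trans (h _ _ _ _ (ny u) (ny v) (qX v) (qX u)) _; lia.
have crossg u v : u \in A -> v \in A -> (q u * g v = q v * g u)%N.
  move=> uA vA; rewrite /g !muln_gcdr; congr gcdn; first exact: mulnC.
  have := congr1 absz (cross _ _ uA vA); rewrite !abszM !absz_nat => E.
  by rewrite mulnC -E mulnC.
have -> : \sum_(u | (n u)%:~R / (q u)%:R + s == z) (g u)%:R^-1 =
    \sum_(u in A) (g u)%:R^-1 :> R by apply: eq_bigl => u; rewrite inE.
have g0 u : (0 < g u)%N by rewrite gcdn_gt0 q0.
apply: sum_inv_half_range => // [u v uA vA guv|u v uA vA]; last first.
  rewrite -(ltn_pmul2l (q0 v)) -crossg // mulnA [(q v * 2)%N]mulnC ltn_pmul2r //.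
  by apply: leq_trans (qX u) _; rewrite leq_mul2l leq_addr.
have quv : q u = q v.
  by apply/eqP; rewrite -(eqn_pmul2r (g0 v)) crossg // guv.
have nuv : n u = n v.
  have := cross _ _ uA vA; rewrite quv; apply: mulIf.
  by rewrite eqz_nat gtn_eqF.
case: u v quv nuv {uA vA guv} => [k i] [k' i'].
rewrite /q /n /= => /addnI kk /addIr [ii].
by congr (_, _); apply: val_inj.
Qed.

(** The tangent point for a fraction is theta h times its gcd weight. The fourth powers then carry
    factors at most 1/g, which sum to at most 1 over each residue z, so the complete fourth moment
    is counted only once. *)
Lemma burgess_upper (R : rcfType) (p e N h X y : nat) (psi : 'F_p -> R[i])
    (s : 'F_p) (theta : R) :
  prime p -> p = (3 * e).+1 -> (1 < e)%N -> (0 < N)%N ->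
  (11 * N ^ 2 + 4 <= 4 * e)%N -> cubic_char e psi -> (0 < h <= p)%N ->
  (0 < X)%N -> (4 * X * y + 2 * X < p)%N -> 0 < theta ->
  \sum_(u : 'I_X * 'I_(2 * y).+1)
    complex.Re (psi (X + u.1)%:R *
      \sum_(j < h) psi ((u.2%:Z - y%:Z)%:~R / (X + u.1)%:R + s + j%:R)) <=
  3 / 4 * (theta * h%:R) * \sum_(u : 'I_X * 'I_(2 * y).+1)
     gcd_weight R (gcdn (X + u.1) `|u.2%:Z - y%:Z|) +
  (2 * h%:R ^+ 2 * p%:R + h%:R ^+ 4 * (2 * p%:R / N%:R + 2)) /
     (4 * (theta * h%:R) ^+ 3).
Proof.
move=> pp pe e1 N0 Ne cpsi /andP[h0 hp] X0 Xyp th0.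
have t0 : 0 < theta * h%:R by rewrite mulr_gt0 ?ltr0n.
set t := theta * h%:R in t0 *; clearbody t.
pose q (u : 'I_X * 'I_(2 * y).+1) := (X + u.1)%N.
pose n (u : 'I_X * 'I_(2 * y).+1) : int := u.2%:Z - y%:Z.
pose g u := gcdn (q u) `|n u|.
pose zpt u : 'F_p := (n u)%:~R / (q u)%:R + s.
pose T z := \sum_(j < h) psi (z + j%:R).
have q0 u : (0 < q u)%N by rewrite addn_gt0 X0.
have g0 u : (0 < g u)%N by rewrite gcdn_gt0 q0.
have qF u : (q u)%:R != 0 :> 'F_p.
  have := @intr_Fp_eq0 p (q u) pp; rewrite -pmulrn => ->.
    by have := q0 u; rewrite lt0n.
  rewrite absz_nat /q; have := ltn_ord u.1; lia.
have norm1 u : sqrnormc (psi (q u)%:R) = 1.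
  rewrite sqrnormcE (conjc_cubic_char _ cpsi) -(cubic_charM cpsi) divff //.
  have p1 : psi 1 != 0 by rewrite (cubic_char_eq0 cpsi) oner_eq0.
  suff -> : psi 1 = 1 by [].
  by apply: (mulfI p1); rewrite -(cubic_charM cpsi) !mulr1.
have pointwise u : complex.Re (psi (q u)%:R * T (zpt u)) <=
    3 / 4 * t * gcd_weight R (g u) +
    (4 * t ^+ 3)^-1 * ((g u)%:R^-1 * sqrnormc (T (zpt u)) ^+ 2).
  have w0 : 0 < gcd_weight R (g u) by apply: lt_le_trans (gcd_weight_ge1 R _).
  apply: le_trans (tangent_fourth_power _ (mulr_gt0 t0 w0)) _.
  set r := complex.Re _; set w := gcd_weight R (g u) in w0 *.
  apply: lerD; first by rewrite mulrA.
  have -> : r ^+ 4 / (4 * (t * w) ^+ 3) = (4 * t ^+ 3)^-1 * ((w ^+ 3)^-1 * r ^+ 4).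
    by field; rewrite !gt_eqF.
  rewrite ler_pM2l ?invr_gt0 ?mulr_gt0 ?exprn_gt0 //.
  have gR : 0 < (g u)%:R :> R by rewrite ltr0n.
  have r4 : r ^+ 4 = (r ^+ 2) ^+ 2 by rewrite -exprM.
  apply: ler_pM.
  - by rewrite invr_ge0 exprn_ge0 // ltW.
  - by rewrite r4 sqr_ge0.
  - by rewrite lef_pV2 ?posrE ?exprn_gt0 // le_cube_gcd_weight.
  have rT : r ^+ 2 <= sqrnormc (T (zpt u)).
    by rewrite -[leRHS]mul1r -(norm1 u) -sqrnormcM lerDl sqr_ge0.
  rewrite r4; apply: lerXn2r; rewrite // nnegrE ?sqr_ge0 //.
  by apply: le_trans rT; exact: sqr_ge0.
apply: le_trans (ler_sum _ (fun u _ => pointwise u)) _.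
rewrite big_split /= -!mulr_sumr lerD2l mulrC ler_pM2r; last first.
  by rewrite invr_gt0 mulr_gt0 ?exprn_gt0.
apply: le_trans (fourth_moment pp pe e1 N0 Ne cpsi hp).
rewrite (partition_big zpt predT) //=; apply: ler_sum => z _.
have -> : \sum_(u | zpt u == z) (g u)%:R^-1 * sqrnormc (T (zpt u)) ^+ 2 =
    (\sum_(u | zpt u == z) (g u)%:R^-1) * sqrnormc (T z) ^+ 2.
  by rewrite mulr_suml; apply: eq_bigr => u /eqP ->.
rewrite -[leRHS]mul1r ler_wpM2r ?sqr_ge0 //.
exact: sum_inv_gcd_fibre.
Qed.

(** * Integers with a large prime factor *)

Lemma dvdn_prod_coprime (s : seq nat) (F : nat -> nat) (N : nat) :
  uniq s -> {in s &, forall p q, p != q -> coprime (F p) (F q)} ->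
  {in s, forall p, F p %| N}%N -> (\prod_(p <- s) F p %| N)%N.
Proof.
elim: s => [|p s IHs] /=; first by rewrite big_nil dvd1n.
case/andP => ps us cF dF; rewrite big_cons Gauss_dvd.
  rewrite dF ?mem_head //= IHs // => [q r qs rs|q qs].
    by apply: cF; rewrite inE ?qs ?rs orbT.
  by apply: dF; rewrite inE qs orbT.
rewrite big_seq; elim/big_ind: _ => [|a b ca cb|q qs]; first exact: coprimen1.
  by rewrite coprimeMr ca cb.
by apply: cF; rewrite ?mem_head ?inE ?qs ?orbT //; apply: contraNneq ps => ->.
Qed.

Lemma coprime_primes (p q : nat) : prime p -> prime q -> p != q -> coprime p q.
Proof. by move=> pp pq npq; rewrite prime_coprime // dvdn_prime2. Qed.

Lemma dvdn_fact_prime (p n : nat) : prime p -> (p %| n`!)%N -> (p <= n)%N.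
Proof.
move=> pp; elim: n => [|n IHn]; first by rewrite dvdn1 => /eqP p1; move: pp; rewrite p1.
rewrite factS Euclid_dvdM // => /orP[/dvdn_leq -> //|/IHn /leqW //].
Qed.

(** Erdős's argument: the primes in (m+1, 2m+1] divide C(2m+1, m), which is at most 4^m because it
    occurs twice in the expansion of 2^(2m+1). An even n > 2 is not prime and reduces to n - 1. *)
Lemma primorial_le (n : nat) : (\prod_(0 <= p < n.+1 | prime p) p <= 4 ^ n)%N.
Proof.
elim/ltn_ind: n => -[|[|[|n]]] IHn.
- by rewrite big_mkcond !big_nat_recr ?big_geq.
- by rewrite big_mkcond !big_nat_recr ?big_geq.
- by rewrite big_mkcond !big_nat_recr ?big_geq.
have [on|en] := boolP (odd n); last first.
  pose m := n.+2./2.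
  have nE : n.+3 = (2 * m).+1 by rewrite /m /=; lia.
  have mn : (m.+1 < n.+3)%N by rewrite nE /m; lia.
  clearbody m.
  rewrite (@big_cat_nat _ _ _ m.+2) //=; last by lia.
  have -> : (4 ^ n.+3 = 4 ^ m.+1 * 4 ^ m)%N by rewrite -expnD; congr (_ ^ _)%N; lia.
  apply: leq_mul; first exact: IHn.
  apply: (@leq_trans 'C((2 * m).+1, m)).
    rewrite -big_filter dvdn_leq ?bin_gt0 //; first by lia.
    apply: dvdn_prod_coprime => [|p q|p].
    - by rewrite filter_uniq ?iota_uniq.
    - rewrite !mem_filter => /andP[pp _] /andP[pq _]; exact: coprime_primes.
    rewrite mem_filter mem_index_iota nE => /and3P[pp mp pm].
    have := bin_fact (_ : m <= (2 * m).+1)%N.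
    have -> : ((2 * m).+1 - m = m.+1)%N by lia.
    move=> /(_ ltac:(lia)) binE.
    have : (p %| (2 * m).+1`!)%N by rewrite dvdn_fact // prime_gt0.
    rewrite -binE Euclid_dvdM // => /orP[//|]; rewrite Euclid_dvdM //.
    by case/orP => h; have := dvdn_fact_prime pp h; lia.
  have : ('C((2 * m).+1, m) + 'C((2 * m).+1, m.+1) <= 2 ^ (2 * m).+1)%N.
    rewrite -[2%N]/(1 + 1)%N [X in (_ <= X)%N]expnDn.
    have i1 : (m < (2 * m).+2)%N by lia.
    have i2 : (m.+1 < (2 * m).+2)%N by lia.
    rewrite (bigD1 (Ordinal i1)) // (bigD1 (Ordinal i2)) /=; last first.
      by rewrite -val_eqE /= neq_ltn ltnSn orbT.
    by rewrite !exp1n !muln1 leq_add2l leq_addr.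
  have -> : 'C((2 * m).+1, m.+1) = 'C((2 * m).+1, m).
    by rewrite -bin_sub; [congr 'C(_, _)|]; lia.
  by rewrite expnS expnM addnn -mul2n leq_mul2l.
have npr : ~~ prime n.+3.
  apply/negP => /even_prime[//|]; by rewrite /= on.
rewrite big_mkcond big_nat_recr //= -big_mkcond (negbTE npr) muln1.
by apply: leq_trans (IHn _ (ltnSn _)) _; rewrite leq_exp2l.
Qed.

(** Induction on k: C((k+1)H, H) k^(kH) is a single term in the binomial expansion of
    (k+1)^((k+1)H). *)
Lemma fact_muln_le (H k : nat) : ((k * H)`! <= k ^ (k * H) * H`! ^ k)%N.
Proof.
elim: k => [|k IHk]; first by rewrite mul0n.
have [->|k0] := posnP k; first by rewrite !mul1n exp1n mul1n.
rewrite -(bin_fact (_ : H <= k.+1 * H)%N) ?leq_pmull //.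
have -> : (k.+1 * H - H = k * H)%N by rewrite mulSn addKn.
have binP : ('C(k.+1 * H, H) * k ^ (k * H) <= k.+1 ^ (k.+1 * H))%N.
  rewrite -[X in (_ <= X ^ _)%N]addn1 expnDn.
  have i1 : (H < (k.+1 * H).+1)%N by rewrite ltnS leq_pmull.
  rewrite (bigD1 (Ordinal i1)) //= exp1n muln1.
  by rewrite {2}mulSn addKn leq_addr.
rewrite [(H`! ^ _)%N]expnS.
apply: (@leq_trans ('C(k.+1 * H, H) * k ^ (k * H) * (H`! * H`! ^ k))%N).
  by rewrite -mulnA leq_mul2l mulnCA leq_mul2l IHk !orbT.
by rewrite leq_mul2r binP orbT.
Qed.

(** A prime p > H does not divide H!, so its power in (kH)!, at least floor (kH/p), survives in the
    multinomial coefficient. *)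
Lemma prod_large_primes_le (H k : nat) :
  (\prod_(H.+1 <= p < (k * H).+1 | prime p) p ^ (k * H %/ p) <= k ^ (k * H))%N.
Proof.
set t := (k * H)%N.
rewrite -(leq_pmul2r (_ : 0 < H`! ^ k)%N) ?expn_gt0 ?fact_gt0 //.
apply: leq_trans (fact_muln_le H k); apply: dvdn_leq; first exact: fact_gt0.
rewrite -big_filter Gauss_dvd.
  apply/andP; split.
    apply: dvdn_prod_coprime => [|p q|p].
    - by rewrite filter_uniq ?iota_uniq.
    - rewrite !mem_filter => /andP[pp _] /andP[pq _] npq.
      by rewrite coprimeXl // coprimeXr // coprime_primes.
    rewrite mem_filter mem_index_iota => /and3P[pp Hp pt].
    rewrite pfactor_dvdn ?fact_gt0 // logn_fact // -/t.
    rewrite big_ltn ?expn1 ?leq_addr //.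
    by apply: leq_trans pt; apply: leq_ltn_trans (prime_gt0 pp) _.
  rewrite /t; elim: k {t} => [|k IHk]; first by rewrite dvd1n.
  rewrite -(bin_fact (_ : H <= k.+1 * H)%N) ?leq_pmull //.
  have -> : (k.+1 * H - H = k * H)%N by rewrite mulSn addKn.
  by rewrite expnS dvdn_mull // dvdn_mul.
rewrite coprimeXr // big_seq; elim/big_ind: _ => [|a b ca cb|p].
- exact: coprime1n.
- by rewrite coprimeMl ca cb.
rewrite mem_filter mem_index_iota => /and3P[pp Hp _].
rewrite coprimeXl // prime_coprime //.
by apply/negP => /(dvdn_fact_prime pp); rewrite leqNgt Hp.
Qed.

(** * Mertens' sum over large primes *)

Lemma ln_prod_nat (R : realType) (s : seq nat) (P : pred nat) (F : nat -> nat) :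
  (forall p, P p -> 0 < F p)%N ->
  ln (\prod_(p <- s | P p) F p)%:R = \sum_(p <- s | P p) ln (F p)%:R :> R.
Proof.
move=> F0; elim: s => [|p s IHs]; first by rewrite !big_nil ln1.
rewrite !big_cons; case: ifP => // Pp.
rewrite natrM lnM ?posrE ?IHs // ltr0n ?F0 //.
by rewrite prodn_cond_gt0.
Qed.

Lemma ln_ge_oneBinv (R : realType) (x : R) : 0 < x -> 1 - x^-1 <= ln x.
Proof.
move=> x0; have xV0 : 0 < x^-1 by rewrite invr_gt0.
have := @le_ln1Dx R (x^-1 - 1); rewrite ltrBrDl subrr => /(_ xV0).
rewrite addrC subrK lnV ?posrE //; lra.
Qed.

(* Discrete form of [1 / ln p] as an integral of [dt / (t ln^2 t)], along the
   points [ell i]. *)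
Lemma inv_step_weight (R : realFieldType) (a d v : R) (b : nat -> bool) (n : nat) :
  0 < a -> 0 <= d -> a <= v ->
  (forall i, ~~ b i -> a + i%:R * d <= v) ->
  1 <= v * ((a + n%:R * d)^-1 + \sum_(i < n) (b i.+1)%:R *
    ((a + i%:R * d)^-1 - (a + i.+1%:R * d)^-1)).
Proof.
move=> a0 d0 av bv.
have ell0 i : 0 < a + i%:R * d by rewrite ltr_pwDl // mulr_ge0.
have step i : 0 <= (a + i%:R * d)^-1 - (a + i.+1%:R * d)^-1.
  by rewrite subr_ge0 lef_pV2 ?posrE // lerD2l ler_wpM2r // ler_nat.
have v0 : 0 < v by apply: lt_le_trans av.
elim: n => [|n IHn].
  by rewrite big_ord0 mul0r !addr0 ler_pdivlMr // mul1r.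
rewrite big_ord_recr /=; have [bn|bn] := boolP (b n.+1).
  rewrite mul1r; apply: le_trans IHn _; rewrite ler_pM2l //.
  by rewrite le_eqVlt; apply/orP; left; apply/eqP; ring.
rewrite mul0r addr0; apply: (@le_trans _ _ (v * (a + n.+1%:R * d)^-1)).
  by rewrite ler_pdivlMr // mul1r bv.
by rewrite ler_pM2l // lerDl sumr_ge0 // => i _; rewrite mulr_ge0.
Qed.

(** Write (i+3) d = (a + i d) + (3d - a). The second part telescopes; the first contributes 1 - x/z
    for consecutive points x < z, at most ln (z/x), which telescopes too. *)
Lemma sum_step_weight (R : realType) (a d : R) (n : nat) : 0 < a -> 0 < d ->
  \sum_(i < n) (i%:R + 3) * d * ((a + i%:R * d)^-1 - (a + i.+1%:R * d)^-1) <=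
  (3 * d - a) * (a^-1 - (a + n%:R * d)^-1) + ln ((a + n%:R * d) / a).
Proof.
move=> a0 d0.
have ell0 i : 0 < a + i%:R * d by rewrite ltr_wpDr // mulr_ge0 // ltW.
elim: n => [|n IHn].
  by rewrite big_ord0 mul0r addr0 subrr mulr0 add0r divff ?gt_eqF // ln1.
rewrite big_ord_recr /=; apply: le_trans (lerD IHn (lexx _)) _.
set x := a + n%:R * d in ell0 *; set z := a + n.+1%:R * d.
have x0 : 0 < x by exact: ell0.
have z0 : 0 < z by exact: ell0.
have lnz : ln (z / a) = ln (x / a) + ln (z / x).
  rewrite -lnM ?posrE ?divr_gt0 //; congr ln.
  by clearbody x z; field; rewrite !gt_eqF.
have := @ln_ge_oneBinv R (z / x); rewrite divr_gt0 // => /(_ isT).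
rewrite lnz invf_div.
have -> : (n%:R + 3) * d * (x^-1 - z^-1) =
    (3 * d - a) * (x^-1 - z^-1) + (1 - x / z).
  have -> : (n%:R + 3) * d = 3 * d - a + x by rewrite /x; ring.
  by clearbody x z; field; rewrite !gt_eqF.
lra.
Qed.

Lemma ln_nat_ge0 (R : realType) (n : nat) : (0 < n)%N -> 0 <= ln n%:R :> R.
Proof. by move=> n0; rewrite ln_ge0 // ler1n. Qed.

(** The part c ln 2 comes from the multinomial bound with k = 2^c, the part 2 ln 2 from the
    primorial. The latter pays for the added 1, which makes the coefficient exceed t/p, so that the
    sum can be rescaled from t to a longer range. *)
Lemma sum_ln_primes_le (R : realType) (H c t : nat) :
  t = (2 ^ c * H)%N -> (0 < H)%N ->
  \sum_(H.+1 <= p < t.+1 | prime p) ((t %/ p)%:R + 1) * ln p%:R <=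
  t%:R * ((c%:R + 2) * ln 2) :> R.
Proof.
move=> tE H0; have t0 : (0 < t)%N by rewrite tE muln_gt0 expn_gt0.
under eq_bigr do rewrite mulrDl mul1r.
rewrite big_split /=.
have h1 : \sum_(H.+1 <= p < t.+1 | prime p) (t %/ p)%:R * ln p%:R <=
    t%:R * (c%:R * ln 2) :> R.
  have <- : \sum_(H.+1 <= p < t.+1 | prime p) ln (p ^ (t %/ p))%:R =
      \sum_(H.+1 <= p < t.+1 | prime p) (t %/ p)%:R * ln p%:R :> R.
    apply: eq_bigr => p pp.
    by rewrite natrX lnXn ?ltr0n ?prime_gt0 // mulr_natl.
  rewrite -ln_prod_nat => [|p pp]; last by rewrite expn_gt0 prime_gt0.
  have -> : t%:R * (c%:R * ln 2) = ln ((2 ^ c) ^ t)%:R :> R.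
    by rewrite -expnM natrX lnXn ?ltr0n // -[RHS]mulr_natl natrM mulrCA mulrA.
  rewrite ler_ln ?posrE ?ltr0n ?expn_gt0 //; last first.
    by rewrite prodn_cond_gt0 // => p pp; rewrite expn_gt0 prime_gt0.
  by rewrite ler_nat tE prod_large_primes_le.
have h2 : \sum_(H.+1 <= p < t.+1 | prime p) ln p%:R <= t%:R * (2 * ln 2) :> R.
  have Ht : (H <= t)%N by rewrite tE leq_pmull // expn_gt0.
  apply: (@le_trans _ _ (\sum_(0 <= p < t.+1 | prime p) ln p%:R)).
    rewrite [leRHS](@big_cat_nat _ _ _ H.+1) //= lerDr.
    by rewrite sumr_ge0 // => p pp; rewrite ln_nat_ge0 ?prime_gt0.
  rewrite -ln_prod_nat => [|p pp]; last exact: prime_gt0.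
  have -> : t%:R * (2 * ln 2) = ln (4 ^ t)%:R :> R.
    rewrite (_ : 4 = 2 ^ 2)%N // -expnM natrX lnXn ?ltr0n // -[RHS]mulr_natl natrM.
    by ring.
  rewrite ler_ln ?posrE ?ltr0n ?expn_gt0 ?ler_nat ?primorial_le //.
  by rewrite prodn_cond_gt0 // => p pp; rewrite prime_gt0.
by apply: le_trans (lerD h1 h2) _; rewrite -mulrDr -mulrDl.
Qed.

(** Partial summation against 1 / ln p, discretised at the points 2^i H up to Y. The term 3 ln 2 is
    the excess of (i+3) ln 2, the bound at the point 2^(i+1) H, over ln (2^i H / H) = i ln 2. *)
Lemma large_prime_multiples_le (R : realType) (H k : nat) :
  (1 < H)%N -> (0 < k)%N ->
  (\sum_(H.+1 <= p < (k * H).+1 | prime p) (k * H %/ p))%:R <=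
  (k * H)%:R * (ln (ln (k * H)%:R / ln H%:R) +
    3 * ln 2 * ((ln H%:R)^-1 - (ln (k * H)%:R)^-1)) :> R.
Proof.
move=> H1 k0; set Y := (k * H)%N; set a : R := ln H%:R; set L : R := ln Y%:R.
have H0 : (0 < H)%N by exact: ltnW.
have Y0 : (0 < Y)%N by rewrite muln_gt0 k0.
set d : R := ln 2.
have d0 : 0 < d by rewrite ln_gt0 // ltr1n.
have a0 : 0 < a by rewrite ln_gt0 // ltr1n.
have [n [nk kn]] : exists n, (2 ^ n <= k)%N /\ (k < 2 ^ n.+1)%N.
  exists (trunc_log 2 k); exact/andP/trunc_log_bounds.
have pow0 i : (0 < 2 ^ i * H)%N by rewrite muln_gt0 expn_gt0.
have lnE i : ln (2 ^ i * H)%:R = a + i%:R * d.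
  rewrite natrM lnM ?posrE ?ltr0n ?expn_gt0 // addrC natrX lnXn ?ltr0n //.
  by rewrite mulr_natl.
set ell := a + n%:R * d.
have ell0 : 0 < ell by rewrite ltr_wpDr // mulr_ge0 // ltW.
have ellL : ell <= L.
  by rewrite /ell -lnE ler_ln ?posrE ?ltr0n // ler_nat leq_mul2r nk orbT.
have Lell : L <= ell + d.
  have -> : ell + d = ln (2 ^ n.+1 * H)%:R by rewrite lnE /ell -natr1; ring.
  by rewrite ler_ln ?posrE ?ltr0n // ler_nat leq_mul2r ltnW ?orbT.
pose w i := (a + i%:R * d)^-1 - (a + i.+1%:R * d)^-1.
have w0 i : 0 <= w i.
  rewrite subr_ge0 lef_pV2 ?posrE ?ltr_wpDr ?mulr_ge0 ?(ltW d0) //.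
  by rewrite lerD2l ler_pM2r // ler_nat.
pose b p i := (p <= 2 ^ i * H)%N.
have weight p : prime p -> (H < p)%N ->
    (Y %/ p)%:R <= ell^-1 * ((Y %/ p)%:R * ln p%:R) +
      \sum_(i < n) w i * ((b p i.+1)%:R * ((Y %/ p)%:R * ln p%:R)).
  move=> pp Hp; have p0 := prime_gt0 pp.
  have av : a <= ln p%:R by rewrite ler_ln ?posrE ?ltr0n // ler_nat ltnW.
  have bv i : ~~ b p i -> a + i%:R * d <= ln p%:R.
    rewrite /b -ltnNge => pi.
    by rewrite -lnE ler_ln ?posrE ?ltr0n // ler_nat ltnW.
  have := inv_step_weight n a0 (ltW d0) av bv; rewrite -/ell => h.
  rewrite -[leLHS]mulr1; apply: le_trans (ler_wpM2l _ h) _ => //.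
  rewrite mulrDr mulrDr mulr_sumr mulr_sumr le_eqVlt; apply/orP; left; apply/eqP.
  congr (_ + _); first by ring.
  by apply: eq_bigr => i _; rewrite /w; ring.
rewrite natr_sum.
apply: (@le_trans _ _ (ell^-1 * (Y%:R * ln k%:R) +
    \sum_(i < n) w i * (Y%:R * ((i%:R + 3) * d)))).
  rewrite big_nat_cond.
  apply: (@le_trans _ _ (\sum_(H.+1 <= p < Y.+1 | prime p)
     (ell^-1 * ((Y %/ p)%:R * ln p%:R) +
      \sum_(i < n) w i * ((b p i.+1)%:R * ((Y %/ p)%:R * ln p%:R))))).
    rewrite [leRHS]big_nat_cond; apply: ler_sum => p /andP[/andP[Hp _] pp].
    exact: weight.
  rewrite big_split /= exchange_big /= -mulr_sumr; apply: lerD.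
    rewrite ler_pM2l ?invr_gt0 //.
    have -> : Y%:R * ln k%:R = ln (k ^ Y)%:R :> R.
      by rewrite natrX lnXn ?ltr0n // mulr_natl.
    have -> : \sum_(H.+1 <= p < Y.+1 | prime p) (Y %/ p)%:R * ln p%:R =
        \sum_(H.+1 <= p < Y.+1 | prime p) ln (p ^ (Y %/ p))%:R :> R.
      apply: eq_bigr => p pp.
      by rewrite natrX lnXn ?ltr0n ?prime_gt0 // mulr_natl.
    rewrite -ln_prod_nat => [|p pp]; last by rewrite expn_gt0 prime_gt0.
    rewrite ler_ln ?posrE ?ltr0n ?expn_gt0 ?k0 //; last first.
      by rewrite prodn_cond_gt0 // => p pp; rewrite expn_gt0 prime_gt0.
    by rewrite ler_nat prod_large_primes_le.
  apply: ler_sum => i _; rewrite -mulr_sumr ler_wpM2l //.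
  set t := (2 ^ i.+1 * H)%N.
  have t0 : (0 < t)%N by rewrite muln_gt0 expn_gt0.
  have tR : 0 < t%:R :> R by rewrite ltr0n.
  have tY : (t <= Y)%N.
    by rewrite leq_mul2r (leq_trans _ nk) ?orbT // leq_exp2l.
  have := @sum_ln_primes_le R H i.+1 t erefl H0.
  rewrite (@big_nat_widen _ _ _ _ _ Y.+1) // => h.
  apply: (@le_trans _ _ (Y%:R / t%:R * (t%:R * ((i.+1%:R + 2) * d)))); last first.
    rewrite le_eqVlt; apply/orP; left; apply/eqP; rewrite -[i.+1%:R]natr1.
    by field; rewrite gt_eqF.
  rewrite -[X in _ <= _ / _ * (t%:R * ((_ + 2) * X))]/(ln 2).
  apply: le_trans (ler_wpM2l _ h); last by rewrite divr_ge0.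
  rewrite mulr_sumr big_mkcondr /=; apply: ler_sum => p pp; rewrite ltnS -/t /b -/t.
  case: (p <= t)%N; last by rewrite mul0r.
  rewrite mul1r mulrA ler_wpM2r ?ln_nat_ge0 ?prime_gt0 //.
  have p0 : 0 < p%:R :> R by rewrite ltr0n prime_gt0.
  apply: le_trans (natr_divn_le _ _ (prime_gt0 pp)) _.
  rewrite -mulrA ler_wpM2l // -(ler_pM2r (mulr_gt0 tR p0)).
  set c := _ + 1; have -> : p%:R^-1 * (t%:R * p%:R) = t%:R :> R.
    by field; rewrite gt_eqF.
  have -> : t%:R^-1 * c * (t%:R * p%:R) = c * p%:R by field; rewrite gt_eqF.
  by rewrite /c natr1 -natrM ler_nat ltnW // ltn_ceil // prime_gt0.
have sumw := @sum_step_weight R a d n a0 d0.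
rewrite -/ell in sumw.
have YR : 0 < Y%:R :> R by rewrite ltr0n.
have -> : \sum_(i < n) w i * (Y%:R * ((i%:R + 3) * d)) =
    Y%:R * \sum_(i < n) (i%:R + 3) * d * w i.
  by rewrite mulr_sumr; apply: eq_bigr => i _; ring.
have lnk : ln k%:R = L - a.
  by rewrite /L /Y natrM lnM ?posrE ?ltr0n // addrK.
rewrite lnk mulrCA -mulrDr ler_pM2l //.
apply: le_trans (lerD (lexx _) sumw) _.
have L0 : 0 < L by apply: lt_le_trans ellL.
have lnLa : ln (L / a) = ln (ell / a) + ln (L / ell).
  rewrite -lnM ?posrE ?divr_gt0 //; congr ln.
  by clearbody ell L; field; rewrite !gt_eqF.
have := @ln_ge_oneBinv R (L / ell); rewrite divr_gt0 // => /(_ isT).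
rewrite invf_div lnLa => lnLell.
rewrite addrA -subr_ge0.
(* The last dyadic point falls short of Y; replacing ell by L costs (L - ell)^2 / (ell L), and L -
   ell is at most d = ln 2. *)
have key : L / ell - 1 - (1 - ell / L) <= d * (ell^-1 - L^-1).
  rewrite -subr_ge0.
  have -> : d * (ell^-1 - L^-1) - (L / ell - 1 - (1 - ell / L)) =
      (L - ell) * (d - (L - ell)) / (ell * L).
    by clearbody ell L; field; rewrite !gt_eqF.
  apply: divr_ge0; last by rewrite mulr_ge0 ?(ltW ell0) ?(ltW L0).
  by apply: mulr_ge0; rewrite subr_ge0 // lerBlDl.
have eqn : ell^-1 * (L - a) + (3 * d - a) * (a^-1 - ell^-1) =
    L / ell - 1 + 3 * d * (a^-1 - ell^-1).
  by clearbody ell L; field; rewrite !gt_eqF.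
rewrite eqn -/d.
have dec : 0 <= d * (ell^-1 - L^-1).
  by rewrite mulr_ge0 ?(ltW d0) // subr_ge0 lef_pV2.
move: dec key lnLell; rewrite !mulrBr.
move: (L / ell) (ell / L) (ln (ell / a)) (ln (L / ell)) => A B C D.
rewrite -!mulrA; move: (d * ell^-1) (d * L^-1) (d * a^-1) => x y z.
lra.
Qed.

(** * Values of a cubic character on smooth integers *)

Definition residue_char (R : realType) (f : nat) (chi : int -> R[i]) (x : 'F_f) :
    R[i] :=
  chi (x : nat)%:Z.

Lemma residue_char_intr (R : realType) (f : nat) (chi : int -> R[i]) (n : int) :
  prime f -> dirichlet_character f chi -> residue_char chi (n%:~R : 'F_f) = chi n.
Proof.
move=> pf [chi_per _ _].
have perM (k : nat) m : chi (m + k%:Z * f%:Z) = chi m.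
  by elim: k => [|k IHk]; rewrite ?mul0r ?addr0 // -addn1 PoszD mulrDl mul1r addrA chi_per.
have perZ (k : int) m : chi (m + k * f%:Z) = chi m.
  case: k => k; first exact: perM.
  by rewrite NegzE mulNr -[LHS](perM k.+1) subrK.
have f0 : f%:R = 0 :> 'F_f by apply/eqP; rewrite -(dvdn_pcharf (pchar_Fp pf)).
have nat_case (r : nat) : residue_char chi (r%:R : 'F_f) = chi r%:Z.
  rewrite /residue_char val_Fp_nat //.
  by rewrite [in RHS](divn_eq r f) addnC PoszD PoszM perZ.
rewrite (divz_eq n f) [X in chi X]addrC perZ.
have : (0 <= n %% f%:Z)%Z by rewrite modz_ge0 // eqz_nat gtn_eqF ?prime_gt0.
case: (n %% f%:Z)%Z => // r _.
by rewrite intrD intrM -!pmulrn f0 mulr0 add0r nat_case.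
Qed.

(** The kernel condition needs a generator g of the unit group: psi g = 1 would make chi principal,
    against the minimality of the order. So psi g is a primitive cube root of unity, psi (g^i) = 1
    forces 3 to divide i, and then the power e kills g^i. *)
Lemma cubic_residue_char (R : realType) (f e : nat) (chi : int -> R[i]) :
  prime f -> f = (3 * e).+1 -> dirichlet_character f chi ->
  character_order f chi 3 -> cubic_char e (residue_char chi : 'F_f -> R[i]).
Proof.
move=> pf fe chi_char [_ chi3 chi_min]; have [_ chiM chi0] := chi_char.
have psi_int := residue_char_intr _ pf chi_char.
pose psi : 'F_f -> R[i] := residue_char chi.
have natE (x : 'F_f) : x = ((x : nat)%:Z)%:~R by rewrite -pmulrn natr_Zp.
have psiM x y : psi (x * y) = psi x * psi y.
  by rewrite {1}(natE x) {1}(natE y) -intrM /psi psi_int chiM.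
have psi_eq0 x : (psi x == 0) = (x == 0).
  rewrite /psi /residue_char -[LHS]negbK chi0 /coprimez /gcdz !absz_nat eqz_nat.
  rewrite -/(coprime _ _) coprime_sym prime_coprime // negbK.
  by rewrite (dvdn_pcharf (pchar_Fp pf)) natr_Zp.
have psi_cube x : x != 0 -> psi x ^+ 3 = 1.
  rewrite -psi_eq0 /psi /residue_char chi0 => cop.
  by rewrite chi3 /principal_character cop.
split=> // x psix.
have psi1 : psi 1 = 1.
  have p1 : psi 1 != 0 by rewrite psi_eq0 oner_eq0.
  by apply: (mulfI p1); rewrite -psiM !mulr1.
have psiX y n : psi (y ^+ n) = psi y ^+ n.
  by elim: n => [|n IHn]; rewrite ?expr0 // !exprS psiM IHn.
have e3 : (3 * e)%N = f.-1 by rewrite fe.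
have f1 : (0 < f.-1)%N by have := prime_gt1 pf; lia.
have unitX (y : 'F_f) : y != 0 -> y ^+ f.-1 = 1.
  move=> y0; apply: (mulfI y0); rewrite mulr1 -exprS prednK ?prime_gt0 //.
  by have := expf_card y; rewrite card_Fp.
have /hasP[g _ prim_g] : has f.-1.-primitive_root (enum (predC1 (0 : 'F_f))).
  apply: has_prim_root => //.
  - apply/allP => y; rewrite mem_enum => y0.
    by rewrite unity_rootE unitX.
  - exact: enum_uniq.
  by rewrite -cardE cardC1 card_Fp.
have x0 : x != 0 by rewrite -psi_eq0 [psi x]psix oner_eq0.
have g0 : g != 0.
  apply/eqP => g0; have := prim_expr_order prim_g.
  by rewrite g0 expr0n gtn_eqF // => /esym/eqP; rewrite oner_eq0.
have psig : psi g != 1.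
  apply/eqP => psig; apply: (chi_min 1%N) => // n; rewrite expr1.
  rewrite -psi_int /principal_character -chi0 -[in RHS]psi_int -/(psi _) psi_eq0.
  have [->|n0] := eqVneq (n%:~R : 'F_f) 0; first by apply/eqP; rewrite psi_eq0.
  have [i ->] := prim_rootP prim_g (unitX _ n0).
  by rewrite psiX psig expr1n.
have [i xg] := prim_rootP prim_g (unitX _ x0).
have i3 : (i %% 3 = 0)%N.
  have := psix; rewrite -/(psi _) xg psiX -(expr_mod i (psi_cube _ g0)).
  have := ltn_pmod i (isT : 0 < 3)%N; case: (i %% 3)%N => [|[|[|//]]] // _.
    by rewrite expr1 => /eqP; rewrite (negbTE psig).
  move=> sq; have := psi_cube _ g0; rewrite exprS sq mulr1 => /eqP.
  by rewrite (negbTE psig).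
rewrite xg -exprM (divn_eq i 3) i3 addn0 -mulnA e3 mulnC exprM.
by rewrite (prim_expr_order prim_g) expr1n.
Qed.

Lemma sum_dvdnS (g n : nat) : (0 < g)%N -> (\sum_(k < n) (g %| k.+1) = n %/ g)%N.
Proof.
move=> g0; elim: n => [|n IHn]; first by rewrite big_ord0 div0n.
by rewrite big_ord_recr /= IHn divnS // addnC.
Qed.

(* The window contains 0, so the two partial multiples at its ends combine. *)
Lemma sum_dvdn_window_le (p n b : nat) : (0 < p)%N -> (b <= n)%N ->
  (\sum_(i < n.+1) ((i%:Z - b%:Z != 0)%R && (p %| `|i%:Z - b%:Z|)) <= n %/ p)%N.
Proof.
move=> p0 bn.
have -> : (\sum_(i < n.+1) ((i%:Z - b%:Z != 0)%R && (p %| `|i%:Z - b%:Z|)) =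
    \sum_(0 <= i < n.+1) ((i != b) && (p %| `|i%:Z - b%:Z|)))%N.
  by rewrite big_mkord; apply: eq_bigr => i _; rewrite subr_eq0 eqz_nat.
rewrite (@big_cat_nat _ _ _ b) ?leqW //= [X in (_ + X)%N]big_ltn ?ltnS // eqxx add0n.
have -> : (\sum_(0 <= i < b) ((i != b) && (p %| `|i%:Z - b%:Z|)) = b %/ p)%N.
  rewrite -sum_dvdnS // big_nat_rev /= add0n big_mkord; apply: eq_bigr => i _.
  have ib := ltn_ord i; rewrite (_ : `|_|%N = i.+1); last by lia.
  by rewrite (_ : (_ != _) = true) //; apply/eqP; lia.
have -> : (\sum_(b.+1 <= i < n.+1) ((i != b) && (p %| `|i%:Z - b%:Z|)) =
    (n - b) %/ p)%N.
  rewrite -sum_dvdnS // -{1}[b.+1]add0n big_addn subSS big_mkord.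
  apply: eq_bigr => i _; rewrite (_ : `|_|%N = i.+1); last by lia.
  by rewrite (_ : (_ != _) = true) //; apply/eqP; lia.
by rewrite -{2}(subnKC bn) divnD // leq_addr.
Qed.

Lemma dirichlet_char1 (R : realType) (f : nat) (chi : int -> R[i]) :
  dirichlet_character f chi -> chi 1 = 1.
Proof.
case=> _ chiM chi0; have c1 : chi 1 != 0 by rewrite chi0 /coprimez gcd1z.
by apply: (mulfI c1); rewrite -chiM !mulr1.
Qed.

(** Both the square and the cube are 1. Thus signs do not matter, and windows around 0 may be
    used. *)
Lemma cubic_charN1 (R : realType) (f : nat) (chi : int -> R[i]) :
  dirichlet_character f chi -> character_order f chi 3 -> chi (-1) = 1.
Proof.
move=> chi_char [_ chi3 _]; have [_ chiM _] := chi_char.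
have sq : chi (-1) ^+ 2 = 1 by rewrite expr2 -chiM mulrNN mulr1 (dirichlet_char1 chi_char).
have := chi3 (-1); rewrite exprS sq mulr1 => ->.
by rewrite /principal_character /coprimez gcdNz gcd1z.
Qed.

Lemma char_eq1_of_primes (R : realType) (f : nat) (chi : int -> R[i]) (m : int) :
  dirichlet_character f chi -> character_order f chi 3 -> m != 0 ->
  (forall p, prime p -> (p %| `|m|)%N -> chi p%:Z = 1) -> chi m = 1.
Proof.
move=> chi_char chi_ord m0 primes1; have [_ chiM _] := chi_char.
have nat_case n : (0 < n)%N -> (forall p, prime p -> (p %| n)%N -> chi p%:Z = 1) ->
    chi n%:Z = 1.
  elim/ltn_ind: n => n IHn n0 pn.
  have [n1|n1] := leqP n 1.
    have -> : n = 1%N by lia.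
    exact: dirichlet_char1 chi_char.
  have pp := pdiv_prime n1; have pdn := pdiv_dvd n.
  rewrite -(divnK pdn) PoszM chiM (pn _ pp pdn) mulr1; apply: IHn.
  - by rewrite ltn_Pdiv // prime_gt1.
  - by rewrite divn_gt0 ?pdiv_gt0 // dvdn_leq.
  by move=> p pr pd; apply: pn => //; apply: dvdn_trans pd (dvdn_div pdn).
have abs1 : chi `|m|%N%:Z = 1 by apply: nat_case => //; rewrite absz_gt0.
have [mE|mE] : m = `|m|%N%:Z \/ m = -1 * `|m|%N%:Z.
  by case: (m) => n; [left|right; rewrite NegzE abszN absz_nat mulN1r].
  by rewrite mE.
by rewrite mE chiM abs1 mulr1 (cubic_charN1 chi_char chi_ord).
Qed.

(** A nonzero m prime to q1 whose prime factors are at most H < q2 has only cubic residues as prime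
    factors, since [Y < f] keeps them prime to f; so chi m = 1. Any other m meets one of the listed
    obstructions, which pays the drop from 1 to -1/2. *)
Lemma Re_char_ge (R : realType) (f : nat) (chi : int -> R[i]) (q1 q2 H Y : nat)
    (m : int) :
  prime f -> dirichlet_character f chi -> character_order f chi 3 ->
  two_smallest (fun q => prime q && cubic_nonresidue chi q%:Z) q1 q2 ->
  (H < q2)%N -> (Y < f)%N -> (`|m| <= Y)%N ->
  1 - 3 / 2 * ((m == 0)%:R + ((m != 0) && (q1 %| `|m|)%N)%:R +
    \sum_(H.+1 <= p < Y.+1 | prime p) ((m != 0) && (p %| `|m|)%N)%:R)
  <= complex.Re (chi m).
Proof.
move=> pf chi_char chi_ord [_ _ _ small] Hq2 Yf mY.
have [_ _ chi0] := chi_char; have [_ chi3 _] := chi_ord.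
have ge_half n : - (1 / 2) <= complex.Re (chi n).
  have := chi3 n; rewrite /principal_character -chi0.
  have [-> _|c0] := eqVneq (chi n) 0; first by rewrite /=; lra.
  move=> /cube_root_of_unity[->|[-> _]]; last by [].
  by rewrite /=; lra.
set S := \sum_(_ <= p < _ | _) _.
have S0 : 0 <= S by rewrite sumr_ge0.
have [m0|m0] := eqVneq m 0.
  by apply: le_trans (ge_half m) => /=; lra.
have [q1m|q1m] := boolP (q1 %| _)%N.
  by apply: le_trans (ge_half m) => /=; lra.
rewrite /= addr0 add0r.
have [/existsP[p /and3P[pp Hp pm]]|no_prime] :=
    boolP [exists p : 'I_Y.+1, [&& prime p, (H < p)%N & (p %| `|m|)%N]].
  apply: le_trans (ge_half m); suff : 1 <= S by lra.
  rewrite /S big_mkcond (bigD1_seq (nat_of_ord p)) ?mem_index_iota ?iota_uniq ?Hp ?ltn_ord //=.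
  by rewrite m0 pp pm lerDl sumr_ge0 // => i _; case: ifP.
rewrite (char_eq1_of_primes chi_char chi_ord m0) /=; first by move: S0; rewrite -/S; lra.
move=> p pp pm; have p_le : (p <= Y)%N.
  by apply: leq_trans mY; rewrite dvdn_leq // absz_gt0.
have pH : (p <= H)%N.
  rewrite leqNgt; apply/negP => Hp; case/existsP: no_prime.
  by exists (Ordinal (p_le : p < Y.+1)%N); rewrite /= pp Hp pm.
have : ~~ (prime p && cubic_nonresidue chi p%:Z).
  apply/negP => Pp; move: q1m; rewrite -(small p Pp) ?pm //.
  exact: leq_ltn_trans pH Hq2.
rewrite pp /cubic_nonresidue negbK !inE => /orP[|/eqP //].
rewrite -[_ == 0]negbK chi0 /coprimez /gcdz !absz_nat eqz_nat -/(coprime _ _).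
by rewrite coprime_sym prime_coprime // gtnNdvd ?prime_gt0 //; apply: leq_ltn_trans Yf.
Qed.

Lemma sum_Re_char_window_ge (R : realType) (f : nat) (chi : int -> R[i])
    (q1 q2 H Y n b : nat) :
  prime f -> dirichlet_character f chi -> character_order f chi 3 ->
  two_smallest (fun q => prime q && cubic_nonresidue chi q%:Z) q1 q2 ->
  (H < q2)%N -> (Y < f)%N -> (n <= Y)%N -> (b <= n)%N -> (0 < q1)%N ->
  n.+1%:R - 3 / 2 * (1 + n%:R / q1%:R +
    (\sum_(H.+1 <= p < Y.+1 | prime p) (Y %/ p))%N%:R)
  <= \sum_(i < n.+1) complex.Re (chi (i%:Z - b%:Z)).
Proof.
move=> pf chi_char chi_ord two Hq2 Yf nY bn q10.
have point (i : 'I_n.+1) : (`|i%:Z - b%:Z| <= Y)%N.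
  by have := ltn_ord i; move: (nat_of_ord i) => {}i; lia.
apply: le_trans (ler_sum _ (fun i _ =>
  Re_char_ge pf chi_char chi_ord two Hq2 Yf (point i))).
rewrite sumrB sumr_const card_ord -mulr_sumr lerD2l lerN2 ler_pM2l; last by lra.
rewrite !big_split /=.
have countR p : (0 < p)%N ->
    \sum_(i < n.+1) ((i%:Z - b%:Z != 0) && (p %| `|i%:Z - b%:Z|)%N)%:R <=
    (n %/ p)%:R :> R.
  move=> p0; rewrite -natr_sum ler_nat.
  by have := sum_dvdn_window_le p0 bn.
apply: lerD; first apply: lerD.
- rewrite (bigD1 (Ordinal (bn : (b < n.+1)%N))) //= subrr eqxx big1 ?addr0 // => i ib.
  by rewrite subr_eq0 eqz_nat -[_ == b]/(i == Ordinal (bn : (b < n.+1)%N)) (negbTE ib).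
- by apply: le_trans (countR _ q10) _; exact: natr_divn_le.
rewrite exchange_big natr_sum; apply: ler_sum => p pp /=.
apply: le_trans (countR _ (prime_gt0 pp)) _.
by rewrite ler_nat leq_div2r.
Qed.

(** For fixed q and j the summand is chi (n + (j - h0) q), so n runs over a shifted window. Centring
    by h0 keeps the shift at most h0 q <= y, hence 0 stays inside and the window count applies. *)
Lemma burgess_lower (R : realType) (f e : nat) (chi : int -> R[i])
    (q1 q2 H Y X y h0 : nat) :
  prime f -> f = (3 * e).+1 -> dirichlet_character f chi ->
  character_order f chi 3 ->
  two_smallest (fun q => prime q && cubic_nonresidue chi q%:Z) q1 q2 ->
  (H < q2)%N -> (Y < f)%N -> (2 * y <= Y)%N -> (0 < q1)%N ->
  (0 < X)%N -> (2 * X < f)%N -> (h0 * (2 * X) <= y)%N ->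
  X%:R * (2 * h0).+1%:R * ((2 * y).+1%:R - 3 / 2 *
    (1 + (2 * y)%:R / q1%:R +
     (\sum_(H.+1 <= p < Y.+1 | prime p) (Y %/ p))%N%:R)) <=
  \sum_(u : 'I_X * 'I_(2 * y).+1)
    complex.Re (@residue_char R f chi (X + u.1)%:R *
      \sum_(j < (2 * h0).+1) @residue_char R f chi
        ((u.2%:Z - y%:Z)%:~R / (X + u.1)%:R + - h0%:R + j%:R)).
Proof.
move=> pf fe chi_char chi_ord two Hq2 Yf yY q10 X0 Xf h0X.
have cpsi := cubic_residue_char pf fe chi_char chi_ord.
pose psi := @residue_char R f chi.
set W := _ - _.
pose G (k : 'I_X) (i : 'I_(2 * y).+1) := complex.Re (psi (X + k)%:R *
      \sum_(j < (2 * h0).+1) psi ((i%:Z - y%:Z)%:~R / (X + k)%:R + - h0%:R + j%:R)).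
rewrite [leRHS](_ : _ = \sum_k \sum_i G k i); last by rewrite pair_bigA.
have perk k : (2 * h0).+1%:R * W <= \sum_i G k i.
  set q := (X + k)%N; have qX : (q < 2 * X)%N.
    by rewrite /q mul2n -addnn ltn_add2l.
  have q0 : q%:R != 0 :> 'F_f.
    rewrite -(dvdn_pcharf (pchar_Fp pf)) gtnNdvd ?addn_gt0 ?X0 //.
    exact: ltn_trans qX Xf.
  have h0q : (h0 * q <= y)%N.
    by apply: leq_trans h0X; rewrite leq_mul2l ltnW ?orbT.
  have jq (j : 'I_(2 * h0).+1) : (j * q <= y + h0 * q)%N.
    have jh : (j * q <= (2 * h0) * q)%N by rewrite leq_mul2r -ltnS ltn_ord orbT.
    by apply: leq_trans jh _; rewrite -mulnA mul2n -addnn leq_add2r.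
  have GE i : G k i = \sum_(j < (2 * h0).+1)
      complex.Re (chi (i%:Z - (y + h0 * q - j * q)%N%:Z)).
    rewrite /G mulr_sumr Re_sum; apply: eq_bigr => j _; congr complex.Re.
    rewrite -(cubic_charM cpsi) -(residue_char_intr _ pf chi_char); congr residue_char.
    rewrite -subzn // PoszD !PoszM !(intrB, intrD, intrM) -!pmulrn.
    by rewrite -/q; move: (q%:R : 'F_f) q0 => Q Q0; field.
  under eq_bigr do rewrite GE.
  rewrite exchange_big /= mulr_natl -[X in _ *+ X]card_ord -sumr_const.
  apply: ler_sum => j _.
  apply: (sum_Re_char_window_ge pf chi_char chi_ord two) => //.
  apply: leq_trans (leq_subr _ _) _.
  by rewrite mul2n -addnn leq_add2l.
rewrite -mulrA mulr_natl -[X in _ *+ X]card_ord -sumr_const.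
by apply: ler_sum => k _.
Qed.

(** * Numerical estimates *)

Lemma le_sqr_trans (R : realDomainType) (a b c : R) :
  0 <= a -> a <= b -> c <= a ^+ 2 -> c <= b ^+ 2.
Proof.
by move=> a0 ab ca; apply: le_trans ca _; rewrite lerXn2r ?nnegrE // (le_trans a0).
Qed.

(** Start from 1 + 51/1600 <= exp (51/1600) and square four times, rounding down to a small fraction
    each time. *)
Lemma ln_329_200_le (R : realType) : ln (329 / 200) <= 51 / 100 :> R.
Proof.
rewrite -ler_expR lnK ?posrE; last by lra.
have -> : 51 / 100 = 16%:R * (51 / 1600) :> R by field.
have e1 : 33 / 31 <= expR (51 / 1600) ^+ 2 :> R.
  apply: (@le_sqr_trans _ (1 + 51 / 1600)); [lra|exact: expR_ge1Dx|].
  by rewrite expr2; lra.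
have e2 : 128 / 113 <= (expR (51 / 1600) ^+ 2) ^+ 2 :> R.
  by apply: le_sqr_trans e1 _; rewrite ?expr2; lra.
have e3 : 68 / 53 <= ((expR (51 / 1600) ^+ 2) ^+ 2) ^+ 2 :> R.
  by apply: le_sqr_trans e2 _; rewrite ?expr2; lra.
have e4 : 329 / 200 <= (((expR (51 / 1600) ^+ 2) ^+ 2) ^+ 2) ^+ 2 :> R.
  by apply: le_sqr_trans e3 _; rewrite ?expr2; lra.
by rewrite expRM_natl; move: e4; rewrite -!exprM.
Qed.

(** From (5/4)^25 >= 2^8. Logarithms are measured in multiples of ln 2 throughout, so no decimal
    value of ln 2 is called for. *)
Lemma ln5_ge (R : realType) : 58 / 25 * ln 2 <= ln 5 :> R.
Proof.
have h1 : 19 / 5 <= ((5 / 4) ^+ 3) ^+ 2 :> R.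
  by rewrite !exprS expr0; lra.
have h2 : 72 / 5 <= (((5 / 4) ^+ 3) ^+ 2) ^+ 2 :> R.
  by apply: le_sqr_trans h1 _; rewrite ?expr2; lra.
have h3 : 207 <= ((((5 / 4) ^+ 3) ^+ 2) ^+ 2) ^+ 2 :> R.
  by apply: le_sqr_trans h2 _; rewrite ?expr2; lra.
have h : 256 <= (5 / 4) ^+ 25 :> R.
  rewrite -!exprM in h3; rewrite exprS; move: (_ ^+ _) h3 => z; lra.
have e256 : 256 = 2 ^+ 8 :> R by rewrite !exprS expr0; lra.
have lnq : ln (5 / 4) = ln 5 - 2 * ln 2 :> R.
  have e4 : 4 = 2 * 2 :> R by lra.
  by rewrite ln_div ?posrE // e4 lnM ?posrE // mulr2n mulrDl mul1r.
move: h; rewrite e256 -ler_ln ?posrE ?exprn_gt0 ?divr_gt0 // !lnXn ?divr_gt0 // lnq.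
by lra.
Qed.

(** The ratio of the bound for L to that for a decreases in ln f, so its worst case is ln f = 337/5
    ln 2, where it is below 329/200. There a >= 20.8 ln 2, and L - a <= 129/329 L, so the second
    term is at most 0.057. *)
Lemma log_ratio_le (R : realType) (lnf a L : R) :
  337 / 5 * ln 2 <= lnf -> 26 / 5 * ln 2 + 29 / 125 * lnf <= a ->
  L <= 9 * ln 2 + 3 / 8 * lnf -> a <= L ->
  ln (L / a) + 3 * ln 2 * (a^-1 - L^-1) <= 567 / 1000.
Proof.
have : 0 < ln 2 :> R by rewrite ln_gt0 // ltr1n.
move: (ln 2) => d d0 lnf_ge a_ge L_le aL.
have a0 : 0 < a by lra.
have L0 : 0 < L by lra.
have La : L <= 329 / 200 * a by lra.
have l1 : ln (L / a) <= 51 / 100.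
  apply: le_trans (ln_329_200_le R); rewrite ler_ln ?posrE ?divr_gt0 //.
  by rewrite ler_pdivrMr.
have l2 : 3 * d * (a^-1 - L^-1) <= 57 / 1000.
  have -> : 3 * d * (a^-1 - L^-1) = 3 * d * (L - a) / (a * L).
    by field; rewrite !gt_eqF.
  rewrite ler_pdivrMr ?mulr_gt0 //.
  have da : d <= 10 / 208 * a by lra.
  apply: (@le_trans _ _ (3 * (10 / 208 * a) * (129 / 329 * L))); last by nra.
  by apply: ler_pM; lra.
by lra.
Qed.

Lemma pow8_succ_le (R : realFieldType) (W : R) : 344 <= W ->
  (W + 1) ^+ 8 <= 128 / 125 * W ^+ 8.
Proof.
move=> W344; have W0 : 0 < W by lra.
have h1 : (W + 1) ^+ 2 <= 172 / 171 * W ^+ 2 by rewrite !expr2; nra.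
have h2 : ((W + 1) ^+ 2) ^+ 2 <= 86 / 85 * (W ^+ 2) ^+ 2.
  apply: (@le_trans _ _ ((172 / 171 * W ^+ 2) ^+ 2)).
    by rewrite lerXn2r ?nnegrE ?sqr_ge0 // mulr_ge0 ?sqr_ge0 //; lra.
  by rewrite exprMn ler_wpM2r ?sqr_ge0 // expr2; lra.
have h3 : (((W + 1) ^+ 2) ^+ 2) ^+ 2 <= 128 / 125 * ((W ^+ 2) ^+ 2) ^+ 2.
  apply: (@le_trans _ _ ((86 / 85 * (W ^+ 2) ^+ 2) ^+ 2)).
    by rewrite lerXn2r ?nnegrE ?sqr_ge0 // mulr_ge0 ?sqr_ge0 //; lra.
  by rewrite exprMn ler_wpM2r ?sqr_ge0 // expr2; lra.
by move: h3; rewrite -!exprM.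
Qed.

(** V stands for w^4 and h2 for h^2. With h near w^2/2 and N near w^4/3 the diagonal and
    off-diagonal parts have the same order: at most 8.33 V and 6.27 V. *)
Lemma moment_numerics (R : realFieldType) (V F h2 N : R) :
  1000 <= V -> 0 <= F -> F <= 128 / 125 * V ^+ 2 -> 123 / 500 * V <= h2 ->
  V <= 3 * N + 2 ->
  2 * F / h2 + (2 * F / N + 2) <= 73 / 5 * V.
Proof.
move=> V0 F0 FV hV NV.
have N0 : 0 < N by lra.
have h0 : 0 < h2 by lra.
have -> : 73 / 5 * V = 833 / 100 * V + (62 / 10 * V + 7 / 100 * V) by field.
apply: lerD; first by rewrite ler_pdivrMr //; clear N N0 NV; nra.
apply: lerD; last by lra.
have NV3 : 331 / 1000 * V <= N by lra.
by rewrite ler_pdivrMr //; clear NV h2 hV h0; nra.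
Qed.

Lemma gcd_weight_numerics (R : realFieldType) (W Q : R) :
  344 <= W -> 0 <= Q -> Q ^+ 2 = 1000 * W ->
  500 * W * (500 * W ^+ 3 + 1) + 77 / 200 * (42 / 25 *
    (500 * W * (500 * W ^+ 3 + 1)) +
    (2 * (500 * W) + 2 * (500 * W + (500 * W ^+ 3 + 1))) * Q) <=
  166 / 100 * (500 * W * (500 * W ^+ 3)).
Proof.
move=> W344 Q0 QW; have W0 : 0 < W by lra.
have {}QW : Q <= 1706 / 1000 * W.
  rewrite -(@ler_pXn2r _ 2) ?nnegrE //; last by lra.
  by rewrite QW !expr2; nra.
set U := W ^+ 3; have WU : 1000 * W <= U by rewrite /U !exprS expr0; nra.
set n := 500 * U + 1.
have U0 : 0 < U by lra.
have n1 : n <= 1001 / 1000 * (500 * U) by rewrite /n; lra.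
have Wn : 500 * W * n <= 500 * W * (1001 / 1000 * (500 * U)).
  by rewrite ler_wpM2l // mulr_ge0 // ltW.
have c : (2 * (500 * W) + 2 * (500 * W + n)) * Q <= 202 / 100 * (500 * U) * (1706 / 1000 * W).
  apply: ler_pM QW; [by clear Wn n1; rewrite /n; lra|exact: Q0|].
  by clear Wn Q0; lra.
clear n1 QW W344 WU; move: (500 * W * n) Wn (_ * Q) c => A WA C WC.
have P0 : 0 < W * U by rewrite mulr_gt0.
apply: (@le_trans _ _ (A * (1 + 77 / 200 * (42 / 25)) + 77 / 200 * C)).
  by rewrite le_eqVlt; apply/orP; left; apply/eqP; ring.
have {}WA : A <= 500 * (1001 / 1000 * 500) * (W * U).
  by apply: le_trans WA _; rewrite le_eqVlt; apply/orP; left; apply/eqP; ring.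
have {}WC : C <= 202 / 100 * 500 * (1706 / 1000) * (W * U).
  by apply: le_trans WC _; rewrite le_eqVlt; apply/orP; left; apply/eqP; ring.
have -> : 166 / 100 * (500 * W * (500 * U)) = 166 / 100 * (500 * 500) * (W * U) by ring.
clear W0 U0 n; move: (W * U) P0 WA WC => P P0 WA WC; lra.
Qed.

(** The value 1 - 3/2 (0.567 + 1/293) is about 0.1444; the bound 293 makes the loss due to q1 small
    enough to leave 0.144. *)
Lemma window_numerics (R : realFieldType) (W q B : R) :
  344 <= W -> 293 <= q -> B <= (500 * W ^+ 3 + 38 * W ^+ 2) * (567 / 1000) ->
  144 / 1000 * (500 * W ^+ 3) <=
  500 * W ^+ 3 + 1 - 3 / 2 * (1 + 500 * W ^+ 3 / q + B).
Proof.
move=> W344 q293 BW; have W0 : 0 < W by lra.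
have W2 : 344 * W <= W ^+ 2 by rewrite expr2 ler_wpM2r // ltW.
have W3 : 344 * W ^+ 2 <= W ^+ 3 by rewrite [W ^+ 3]exprS ler_wpM2r // exprn_ge0 // ltW.
move: (W ^+ 2) (W ^+ 3) W2 W3 BW => T U W2 W3 BW.
have U0 : 0 <= 500 * U by lra.
have qU : 500 * U / q <= 500 * U / 293 by rewrite ler_wpM2l // lef_pV2 ?posrE; lra.
by move: (500 * U / q) qU => z; lra.
Qed.

(* The left side of the Burgess inequality is at least 0.144 of the trivial
   bound, the right side at most 0.129 of it. *)
Lemma burgess_numerics (R : realFieldType) (W F h N q B Q Phi : R) :
  344 <= W -> 0 <= F -> F <= (W + 1) ^+ 8 -> W ^+ 2 <= 2 * h + 1 ->
  W ^+ 4 <= 3 * N + 2 -> 293 <= q ->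
  B <= (500 * W ^+ 3 + 38 * W ^+ 2) * (567 / 1000) ->
  0 <= Q -> Q ^+ 2 = 1000 * W ->
  Phi <= 500 * W * (500 * W ^+ 3 + 1) + 77 / 200 * (42 / 25 *
    (500 * W * (500 * W ^+ 3 + 1)) +
    (2 * (500 * W) + 2 * (500 * W + (500 * W ^+ 3 + 1))) * Q) ->
  3 / 4 * (3 / 40 * h) * Phi +
    (2 * h ^+ 2 * F + h ^+ 4 * (2 * F / N + 2)) / (4 * (3 / 40 * h) ^+ 3) <
  500 * W * h * (500 * W ^+ 3 + 1 - 3 / 2 * (1 + 500 * W ^+ 3 / q + B)).
Proof.
move=> W344 F0 FW hW NW q293 BW Q0 QW PhiW.
have PhiU := le_trans PhiW (gcd_weight_numerics W344 Q0 QW).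
have lower := window_numerics W344 q293 BW; clear PhiW Q0 QW Q.
have W0 : 0 < W by lra.
have F8 : F <= 128 / 125 * (W ^+ 4) ^+ 2.
  by rewrite -exprM; exact: le_trans FW (pow8_succ_le W344).
have [W2 V0] : 10000 <= W ^+ 2 /\ 1000 <= W ^+ 4.
  have W2 : 10000 <= W ^+ 2 by rewrite expr2; nra.
  split=> //; rewrite (exprM W 2 2) expr2; nra.
have h0 : 0 < h by clear -hW W2; lra.
have N0 : 0 < N by clear -NW V0; lra.
have h2 : 123 / 500 * W ^+ 4 <= h ^+ 2.
  have hl : 499 / 1000 * W ^+ 2 <= h by clear -hW W2; lra.
  apply: (@le_trans _ _ ((499 / 1000 * W ^+ 2) ^+ 2)).
    rewrite exprMn -exprM ler_wpM2r ?exprn_ge0 ?ltW //.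
    by clear; rewrite expr2; lra.
  by rewrite lerXn2r ?nnegrE ?(ltW h0) // mulr_ge0 ?exprn_ge0 ?(ltW W0) //; clear; lra.
have moment := moment_numerics V0 F0 F8 h2 NW.
(* The factor 16000/27 is 1 / (4 (3/40)^3). *)
have -> : (2 * h ^+ 2 * F + h ^+ 4 * (2 * F / N + 2)) / (4 * (3 / 40 * h) ^+ 3) =
   h * ((2 * F / h ^+ 2 + (2 * F / N + 2)) * (16000 / 27)).
  by clear -h0 N0; field; rewrite !gt_eqF.
have -> : 500 * W * h * (500 * W ^+ 3 + 1 - 3 / 2 * (1 + 500 * W ^+ 3 / q + B)) =
   h * (500 * W * (500 * W ^+ 3 + 1 - 3 / 2 * (1 + 500 * W ^+ 3 / q + B))).
  by clear; ring.
have -> : 3 / 4 * (3 / 40 * h) * Phi = h * (9 / 160 * Phi) by clear; field.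
rewrite -mulrDr ltr_pM2l //.
apply: (@lt_le_trans _ _ (500 * W * (144 / 1000 * (500 * W ^+ 3)))); last first.
  by rewrite ler_pM2l // mulr_gt0.
have -> : 500 * W * (144 / 1000 * (500 * W ^+ 3)) = 500 * (72 * W ^+ 4).
  by clear; field.
have PhiV : Phi <= 500 * (830 * W ^+ 4).
  by apply: le_trans PhiU _; clear; rewrite le_eqVlt; apply/orP; left; apply/eqP; field.
clear -V0 moment PhiV.
move: (_ + _) (W ^+ 4) V0 moment PhiV => S V V0 moment PhiV.
lra.
Qed.

Lemma exists_eighth_root (f : nat) : exists w, (w ^ 8 <= f)%N /\ (f < w.+1 ^ 8)%N.
Proof.
have ex0 : exists w, (w ^ 8 <= f)%N by exists 0%N.
have bounded w : (w ^ 8 <= f)%N -> (w <= f)%N.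
  by apply: leq_trans; rewrite -{1}[w]expn1; case: w => // w; rewrite leq_pexp2l.
case: (ex_maxnP ex0 bounded) => w wf wmax; exists w; split=> //.
by rewrite ltnNge; apply/negP => /wmax; rewrite ltnn.
Qed.

Lemma powR_quarter_le (R : realType) (F W : R) (r : R) :
  1 <= F -> 0 <= W -> F <= W ^+ 8 -> r <= 1 / 4 -> F `^ r <= W ^+ 2.
Proof.
move=> F1 W0 FW r4; apply: le_trans (ler_powR F1 r4) _.
apply: (@le_trans _ _ ((W ^+ 8) `^ (1 / 4))).
  by apply: ge0_ler_powR; rewrite ?nnegrE ?exprn_ge0 //; lra.
suff -> : (W ^+ 8) `^ (1 / 4) = W ^+ 2 by [].
by rewrite -!powR_mulrn // -powRrM; congr (_ `^ _); lra.
Qed.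

Lemma ln_conductor_ge (R : realType) (F : R) : 2 * 10 ^+ 20 <= F ->
  337 / 5 * ln 2 <= ln F.
Proof.
move=> FF; have t0 : 0 < 2 * 10 ^+ 20 :> R by rewrite mulr_gt0 ?exprn_gt0.
apply: (@le_trans _ _ (ln (2 * 10 ^+ 20))); last first.
  by rewrite ler_ln // posrE // (lt_le_trans t0).
have e10 : 10 = 2 * 5 :> R by lra.
rewrite lnM ?posrE ?exprn_gt0 // lnXn // e10 lnM ?posrE //.
have := ln5_ge R; lra.
Qed.

Lemma ln_184_5_ge (R : realType) : 26 / 5 * ln 2 <= ln (184 / 5) :> R.
Proof.
have h : 2 ^+ 11 <= (23 / 5) ^+ 5 :> R by rewrite !exprS expr0; lra.
have e : 184 / 5 = 2 ^+ 3 * (23 / 5) :> R by rewrite !exprS expr0; lra.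
rewrite e lnM ?posrE ?divr_gt0 ?exprn_gt0 // lnXn //.
move: h; rewrite -ler_ln ?posrE ?exprn_gt0 ?divr_gt0 // !lnXn ?divr_gt0 //.
by lra.
Qed.

(** 344 is the integer part of the eighth root of 2 * 10^20; after removing 2^21 the comparison is 8
    * 43^8 <= 5^20. *)
Lemma ge_344_of_conductor (R : realFieldType) (F W : R) :
  2 * 10 ^+ 20 <= F -> F < (W + 1) ^+ 8 -> 0 <= W -> 343 < W.
Proof.
move=> F20 FW W0; rewrite ltNge; apply/negP => W343.
have : (W + 1) ^+ 8 <= 2 * 10 ^+ 20.
  apply: (@le_trans _ _ (344 ^+ 8)).
    by rewrite lerXn2r ?nnegrE; lra.
  have h : 8 * 43 ^+ 8 <= 5 ^+ 20 :> R by rewrite -subr_ge0; lra.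
  have -> : 344 = 2 ^+ 3 * 43 :> R by rewrite !exprS expr0; lra.
  have -> : 10 = 2 * 5 :> R by lra.
  rewrite [(_ * 43) ^+ 8]exprMn [(2 * 5) ^+ 20]exprMn -exprM.
  have -> : 2 * (2 ^+ 20 * 5 ^+ 20) = 2 ^+ 21 * 5 ^+ 20 :> R by rewrite [2 ^+ 21]exprS mulrA.
  have -> : 2 ^+ (3 * 8) * 43 ^+ 8 = 2 ^+ 21 * (8 * 43 ^+ 8) :> R.
    have -> : 8 = 2 ^+ 3 :> R by rewrite !exprS expr0; lra.
    by rewrite mulrA -exprD.
  by rewrite ler_pM2l ?exprn_gt0.
by move=> h; have := lt_le_trans FW (le_trans h F20); rewrite ltxx.
Qed.

Lemma large_prime_multiples_numerics (R : realType) (f w H k : nat) :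
  2 * 10 ^+ 20 <= f%:R :> R -> (344 <= w)%N -> (w ^ 8 <= f)%N ->
  (H <= 38 * w ^ 2)%N -> 184 / 5 * f%:R `^ (29 / 125) <= H%:R :> R ->
  (1 < H)%N -> (0 < k)%N -> (k * H <= 500 * w ^ 3 + H)%N ->
  (\sum_(H.+1 <= p < (k * H).+1 | prime p) (k * H %/ p))%N%:R <=
    (500 * w%:R ^+ 3 + 38 * w%:R ^+ 2) * (567 / 1000) :> R.
Proof.
move=> F20 w344 wf Hw HF H1 k0 kH.
have H0 : (0 < H)%N by exact: ltnW.
have w0 : (0 < w)%N by exact: leq_trans w344.
have Fpos : 0 < f%:R :> R by apply: lt_le_trans F20; rewrite mulr_gt0 ?exprn_gt0.
have f0 : (0 < f)%N by rewrite -(ltr0n R).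
have Y0 : (0 < k * H)%N by rewrite muln_gt0 k0.
apply: le_trans (large_prime_multiples_le R H1 k0) _.
apply: ler_pM => //.
- have a0 : 0 < ln H%:R :> R by rewrite ln_gt0 // ltr1n.
  have aL : ln H%:R <= ln (k * H)%:R :> R.
    by rewrite ler_ln ?posrE ?ltr0n // ler_nat leq_pmull.
  have L0 := lt_le_trans a0 aL.
  apply: addr_ge0.
    by rewrite ln_ge0 // ler_pdivlMr // mul1r.
  by rewrite !mulr_ge0 ?ln_nat_ge0 // subr_ge0 lef_pV2 ?posrE.
- rewrite -!natrX -!natrM -natrD ler_nat; apply: leq_trans kH _.
  by rewrite leq_add2l.
apply: log_ratio_le (ln_conductor_ge F20) _ _ _.
- apply: (@le_trans _ _ (ln (184 / 5 * f%:R `^ (29 / 125)))).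
    rewrite lnM ?posrE ?divr_gt0 ?powR_gt0 // ln_powR lerD2r.
    exact: ln_184_5_ge.
  by rewrite ler_ln // posrE ?(ltr0n _ H) // mulr_gt0 ?divr_gt0 ?powR_gt0.
(* The extra H <= 38 w^2 fits into 12 w^3, and 512 = 2^9 accounts for the 9 ln 2. *)
- apply: (@le_trans _ _ (ln (512 * w ^ 3)%:R)).
    rewrite ler_ln ?posrE ?ltr0n ?muln_gt0 ?expn_gt0 ?w0 ?H0 ?k0 // ler_nat.
    apply: leq_trans kH _; rewrite (_ : 512 = 500 + 12)%N // mulnDl leq_add2l.
    by apply: leq_trans Hw _; rewrite [(w ^ 3)%N]expnS mulnA leq_mul2r; lia.
  have ln512 : ln (512 * w ^ 3)%:R = 9 * ln 2 + 3 * ln w%:R :> R.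
    rewrite (_ : 512 = 2 ^ 9)%N // natrM lnM ?posrE ?ltr0n ?expn_gt0 ?w0 //.
    by rewrite !natrX !lnXn ?ltr0n //; lra.
  have lnw : 8 * ln w%:R <= ln f%:R :> R.
    rewrite mulr_natl -lnXn ?ltr0n // ler_ln ?posrE ?exprn_gt0 ?ltr0n //.
    by rewrite -natrX ler_nat.
  by rewrite ln512; lra.
by rewrite ler_ln ?posrE ?ltr0n // ler_nat leq_pmull.
Qed.

(** With X = 500 w and y = 250 w^3, the integer part of w^2/4 is the largest h0 satisfying 2 X h0 <=
    y. The choice N near w^4/3 almost exhausts Stepanov's condition, since 11/9 < 4/3, and 4 X y =
    500000 w^4 is far below w^8. *)
Lemma burgess_parameters (w f e : nat) (N := (w ^ 4 %/ 3)%N) (h0 := (w ^ 2 %/ 4)%N) :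
  (344 <= w)%N -> (w ^ 8 <= f)%N -> f = (3 * e).+1 ->
  [/\ (0 < N)%N, (1 < e)%N, (11 * N ^ 2 + 4 <= 4 * e)%N,
      (w ^ 4 <= 3 * N + 2)%N & (w ^ 2 <= (2 * h0).+1 * 2 + 1)%N] /\
  [/\ (4 * (500 * w) * (250 * w ^ 3) + 2 * (500 * w) < f)%N,
      (500 * w ^ 3 + 38 * w ^ 2 < f)%N,
      (h0 * (2 * (500 * w)) <= 250 * w ^ 3)%N & ((2 * h0).+1 <= f)%N].
Proof.
move=> w344 wf fe.
have w2 : (344 * w <= w ^ 2)%N by rewrite expnS expn1 leq_mul2r w344 orbT.
have w3 : (344 * w ^ 2 <= w ^ 3)%N by rewrite [(w ^ 3)%N]expnS leq_mul2r w344 orbT.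
have w4 : (344 * w ^ 3 <= w ^ 4)%N by rewrite [(w ^ 4)%N]expnS leq_mul2r w344 orbT.
have v8 : (w ^ 4 * w ^ 4 <= f)%N by rewrite -expnD.
have N1 : (3 * N <= w ^ 4)%N by rewrite mulnC leq_trunc_div.
have N2 : (w ^ 4 < 3 * N.+1)%N by rewrite mulnC ltn_ceil.
have h1 : (4 * h0 <= w ^ 2)%N by rewrite mulnC leq_trunc_div.
have h2 : (w ^ 2 < 4 * h0.+1)%N by rewrite mulnC ltn_ceil.
have w13 : (w * w ^ 3 = w ^ 4)%N by rewrite -expnS.
have w12 : (w * w ^ 2 = w ^ 3)%N by rewrite -expnS.
have NN : (3 * N * (3 * N) <= w ^ 4 * w ^ 4)%N by exact: leq_mul.
have h0w : (4 * h0 * w <= w ^ 3)%N by rewrite -w12 [(w * _)%N]mulnC leq_mul2r h1 orbT.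
rewrite expnS expn1.
move: (w ^ 4)%N (w ^ 3)%N (w ^ 2)%N N h0 w2 w3 w4 v8 N1 N2 h1 h2 w13 w12 NN h0w.
move=> v u t {}N {}h0 w2 w3 w4 v8 N1 N2 h1 h2 w13 w12 NN h0w.
have vv : (344 * 344 * 344 * v <= v * v)%N by rewrite leq_mul2r; apply/orP; right; lia.
have -> : (4 * (500 * w) * (250 * u) = 500 * 1000 * v)%N by rewrite -w13; lia.
rewrite (_ : 3 * N * (3 * N) = 9 * (N * N))%N in NN; last by lia.
have -> : (h0 * (2 * (500 * w)) = 250 * (4 * h0 * w))%N by lia.
clear w13 w12 wf; move: (v * v)%N (N * N)%N (4 * h0 * w)%N vv v8 NN h0w => V NN' hw.
by move=> vv v8 NN h0w; split; split; lia.
Qed.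

Theorem theorem18 (R : realType) (f : nat) (chi : int -> R[i]) (q1 q2 : nat)
    (f_prime : prime f)
    (f_bounds : 2 * 10 ^+ 20 <= (f%:R : R) <= 4 * 10 ^+ 49)
    (f_mod3 : f = 1 %[mod 3])
    (chi_char : dirichlet_character f chi)
    (chi_order : character_order f chi 3)
    (q12 : two_smallest (fun q => prime q && cubic_nonresidue chi q%:Z) q1 q2)
    (q1_ge : (293 <= q1)%N) :
  (q1%:R : R) <= q2%:R <= 37 * (f%:R : R) `^ (232 / 1000).
Proof.
have [_ _ q1q2 _] := q12.
apply/andP; split; first by rewrite ler_nat ltnW.
rewrite leNgt; apply/negP => q2_gt.
have F20 := proj1 (andP f_bounds).
have r29 : 232 / 1000 = 29 / 125 :> R by lra.
rewrite r29 in q2_gt.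
pose F : R := f%:R; pose P := F `^ (29 / 125).
have F1 : 1 <= F.
  apply: le_trans F20; rewrite -[X in X <= _]mulr1 ler_pM ?exprn_ege1 //; lra.
have [w [wf fw]] := exists_eighth_root f.
pose W : R := w%:R.
have FW : F < (W + 1) ^+ 8 by rewrite /F /W natr1 -natrX ltr_nat.
have w344 : (344 <= w)%N.
  by have := ge_344_of_conductor F20 FW (ler0n _ _); rewrite /W ltr_nat.
have w0 : (0 < w)%N by exact: leq_trans w344.
have W344 : 344 <= W by rewrite /W ler_nat.
have P5 : 5 <= P.
  apply: (@le_trans _ _ (F `^ (1 / 20))); last by apply: ler_powR => //; lra.
  have -> : 5 = (5 ^+ 20) `^ (1 / 20) :> R.
    by rewrite -powR_mulrn // -powRrM (_ : _ * _ = 1) ?powRr1 //; lra.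
  have F0 : 0 <= F by apply: le_trans F1.
  apply: ge0_ler_powR; rewrite ?nnegrE ?exprn_ge0 //; first by lra.
  apply: le_trans F20; rewrite -[X in X <= _]mul1r.
  apply: ler_pM; rewrite ?exprn_ge0 //; first by lra.
  by rewrite lerXn2r ?nnegrE //; lra.
pose H := Num.truncn (37 * P).
have /andP[HP PH] : H%:R <= 37 * P < H.+1%:R by apply: truncn_itv; lra.
have Hq2 : (H < q2)%N by rewrite -(ltr_nat R); apply: le_lt_trans q2_gt.
have H1 : (1 < H)%N by rewrite -(ltr_nat R); move: PH; rewrite -natr1; lra.
have H0 : (0 < H)%N by exact: ltnW.
have Hw : (H <= 38 * w ^ 2)%N.
  have PW : P <= (W + 1) ^+ 2.
    apply: powR_quarter_le => //; [by lra|exact: ltW|by lra].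
  rewrite -(ler_nat R) natrM natrX -/W; apply: le_trans HP _.
  apply: (@le_trans _ _ (37 * (W + 1) ^+ 2)); first by rewrite ler_pM2l.
  by clear -W344; rewrite !expr2; nra.
(* Rounding down loses less than 1 <= P/5, and 37 - 1/5 = 184/5. *)
have HF : 184 / 5 * P <= H%:R by move: PH P5; rewrite -natr1; lra.
pose y := (250 * w ^ 3)%N; pose X := (500 * w)%N.
pose h0 := (w ^ 2 %/ 4)%N; pose N := (w ^ 4 %/ 3)%N.
(* [k * H] is the first multiple of H above 2y: the multinomial estimate works with multiples of H
   and must cover the window. *)
pose e := (f %/ 3)%N; pose k := ((2 * y) %/ H).+1.
have fe : f = (3 * e).+1.
  have := divn_eq f 3; rewrite (_ : (f %% 3 = 1)%N) ?f_mod3 //.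
  by rewrite -/e mulnC addn1.
have y2 : (2 * y = 500 * w ^ 3)%N by rewrite /y mulnA.
have kH : (k * H <= 500 * w ^ 3 + H)%N.
  by rewrite /k mulSn addnC leq_add2r -y2 leq_trunc_div.
have yk : (2 * y <= k * H)%N by rewrite ltnW // ltn_ceil.
have [[N0 e1 Ne N3 hw] [Xf kf h0X hf]] := burgess_parameters w344 wf fe.
rewrite -/N -/h0 -/y -/X in N0 Ne N3 hw Xf h0X hf.
have cpsi := cubic_residue_char f_prime fe chi_char chi_order.
have X0 : (0 < X)%N by rewrite muln_gt0.
have kHf : (k * H < f)%N.
  by apply: leq_ltn_trans kH (leq_ltn_trans _ kf); rewrite leq_add2l.
have q1_gt0 : (0 < q1)%N by apply: leq_trans q1_ge.
have hf0 : (0 < (2 * h0).+1 <= f)%N by rewrite hf.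
(* The upper bound has the form A theta + B / theta^3, smallest where the first term is three times
   the second; here that is close to 3/40. *)
have theta0 : 0 < 3 / 40 :> R by rewrite divr_gt0.
have upper := burgess_upper (- h0%:R) f_prime fe e1 N0 Ne cpsi hf0 X0 Xf theta0.
have lower := burgess_lower f_prime fe chi_char chi_order q12 Hq2 kHf yk
  q1_gt0 X0 (leq_ltn_trans (leq_addl _ _) Xf) h0X.
have primes := large_prime_multiples_numerics F20 w344 wf Hw HF H1 (ltn0Sn _) kH.
have weights := sum_gcd_weight R (2 * y).+1 y X0.
have XE : X%:R = 500 * W :> R by rewrite natrM.
have nE : (2 * y)%:R = 500 * W ^+ 3 :> R by rewrite y2 natrM natrX.
have n1E : (2 * y).+1%:R = 500 * W ^+ 3 + 1 :> R by rewrite -natr1 nE.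
have hW : W ^+ 2 <= 2 * (2 * h0).+1%:R + 1 :> R.
  by rewrite -natrX -natrM natr1 ler_nat; move: hw; rewrite addn1 mulnC.
have NW : W ^+ 4 <= 3 * N%:R + 2 :> R.
  by rewrite -natrX -natrM -natrD ler_nat.
have q293 : 293 <= q1%:R :> R by rewrite ler_nat.
have Q0 : 0 <= Num.sqrt (2 * (500 * W)) :> R by exact: sqrtr_ge0.
have QW : Num.sqrt (2 * (500 * W)) ^+ 2 = 1000 * W :> R.
  by rewrite sqr_sqrtr ?mulr_ge0 //; clear; ring.
rewrite XE n1E in weights; rewrite XE n1E nE in lower.
have F0 : 0 <= F by apply: le_trans F1.
have := burgess_numerics W344 F0 (ltW FW) hW NW q293 primes Q0 QW weights.
by move/lt_le_trans/(_ (le_trans lower upper)); rewrite ltxx.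
Qed.
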